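(* Let $Z=mP_1+\cdots+mP_s\subseteq\mathbb{P}^n$ be a homogeneous fat point scheme such that $\operatorname{Supp}(Z)=\{P_1,\dots,P_s\}$ is a complete intersection. Then the tuple $\deg_Z(P_i)$ is the same for every $P_i\in\operatorname{Supp}(Z)$. In particular, the schemes $Z'=mP_1+\cdots+(m-1)P_i+\cdots+mP_s$, for $i=1,\dots,s$, all have the same Hilbert function.
   Context: $k$ is an algebraically closed field of characteristic zero, $n\ge 1$, and $R=k[x_0,\dots,x_n]$ with the standard grading, the homogeneous coordinate ring of $\mathbb{P}^n=\mathbb{P}^n_k$. For distinct points $P_1,\dots,P_s\in\mathbb{P}^n$ ($s \geq 1$) and positive integers $m_1,\dots,m_s$, the set of fat points $Z=m_1P_1+\cdots+m_sP_s$ is the scheme defined by $I_Z=I_{P_1}^{m_1}\cap\cdots\cap I_{P_s}^{m_s}$, where $I_{P_j}\subseteq R$ is the homogeneous prime ideal of $P_j$. Its degree is $\deg Z=\sum_{j=1}^s\binom{m_j+n-1}{n}$, its support is the reduced set of points $\operatorname{Supp}(Z)=\{P_1,\dots,P_s\}$, and $Z$ is homogeneous if $m_1=\cdots=m_s=m$. The Hilbert function of $Z$ is $H_Z(t)=\dim_k(R/I_Z)_t$, $t\in\mathbb{N}$. A reduced finite set of points $X\subseteq\mathbb{P}^n$ is a complete intersection if its homogeneous ideal $I_X$ is generated by $n$ forms $G_1,\dots,G_n$ (which then form a regular sequence). Fix $i$, and let $Z'=m_1P_1+\cdots+(m_i-1)P_i+\cdots+m_sP_s$; if $m_i-1=0$,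 the point $P_i$ is omitted from $Z'$ (and if no point remains, $I_{Z'}=R$ and $\deg Z'=0$). A separator of $P_i$ of multiplicity $m_i$ is a form $F$ with $F\in I_{P_i}^{m_i-1}\setminus I_{P_i}^{m_i}$ and $F\in I_{P_j}^{m_j}$ for all $j\ne i$. A minimal set of separators of $P_i$ of multiplicity $m_i$ is a set of $\nu=\deg Z-\deg Z'$ homogeneous polynomials $\{F_1,\dots,F_\nu\}$, each a separator of $P_i$ of multiplicity $m_i$, such that $I_{Z'}/I_Z=(\overline{F}_1,\dots,\overline{F}_\nu)$ in $R/I_Z$ and no set of fewer than $\nu$ elements generates $I_{Z'}/I_Z$. Such sets exist, and, after ordering so that $\deg F_1\le\cdots\le\deg F_\nu$, the tuple $\deg_Z(P_i):=(\deg F_1,\dots,\deg F_\nu)$ does not depend on the choice of the minimal set of separators. *)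

(* Defs.v *)
From HB Require Import structures.
From mathcomp Require Import all_boot all_order all_algebra.
From mathcomp Require Export mpoly.
From Stdlib Require Import Classical ClassicalEpsilon.

Set Implicit Arguments.
Unset Strict Implicit.
Unset Printing Implicit Defensive.

Import GRing.Theory.
Local Open Scope ring_scope.

Definition ideal_gen (R : comNzRingType) (S : R -> Prop) (f : R) : Prop :=
  exists (r : nat) (a g : 'I_r -> R),
    (forall l, S (g l)) /\ f = \sum_(l < r) a l * g l.

(* For m = 0 the only product is the empty one, so [ideal_pow I 0] is the unit
   ideal: a point of multiplicity 0 imposes no condition. *)
Definition ideal_pow (R : comNzRingType) (I : R -> Prop) (m : nat) : R -> Prop :=
  ideal_gen (fun f => exists g : 'I_m -> R,
    (forall l, I (g l)) /\ f = \prod_(l < m) g l).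

(** A point of P^n is given by a nonzero row of n + 1 homogeneous coordinates;
    two rows give the same point when they are proportional. *)

Section FatPoints.

Variables (k : closedFieldType) (n : nat).
Implicit Types (I J : {mpoly k[n.+1]} -> Prop).

Definition vanishing_ideal (X : 'rV[k]_n.+1 -> Prop) : {mpoly k[n.+1]} -> Prop :=
  ideal_gen (fun f => (exists d : nat, f \is d.-homog) /\
    forall p, X p -> f.@[fun j => p 0 j] = 0).

Definition point_ideal (p : 'rV[k]_n.+1) : {mpoly k[n.+1]} -> Prop :=
  vanishing_ideal (fun q => q = p).

Definition distinct_points s (P : 'I_s -> 'rV[k]_n.+1) : Prop :=
  (forall i, P i != 0) /\
  (forall i j, i != j -> forall c : k, P j <> c *: P i).

Definition complete_intersection s (P : 'I_s -> 'rV[k]_n.+1) : Prop :=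
  exists G : 'I_n -> {mpoly k[n.+1]},
    (forall l, exists d : nat, G l \is d.-homog) /\
    (forall f, vanishing_ideal (fun p => exists i, p = P i) f <->
               ideal_gen (fun g => exists l, g = G l) f).

Definition fat_ideal s (P : 'I_s -> 'rV[k]_n.+1) (m : 'I_s -> nat)
    (f : {mpoly k[n.+1]}) : Prop :=
  forall j, ideal_pow (point_ideal (P j)) (m j) f.

Definition fat_degree s (m : 'I_s -> nat) : nat :=
  (\sum_(j < s) 'C(m j + n - 1, n))%N.

Definition lower_mult s (m : 'I_s -> nat) (i : 'I_s) : 'I_s -> nat :=
  fun j => (m j - (j == i))%N.

(* R_t / I_t is isomorphic to k^d. *)
Definition quot_dim I (t d : nat) : Prop :=
  exists phi : 'Hom(dhomog n.+1 k t, 'rV[k]_d),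
    (forall v, exists f, phi f = v) /\ (forall f, phi f = 0 <-> I f).

(* The dimension of R_t / I_t; well defined for fat point ideals by [hilbertP]. *)
Definition hilbert I (t : nat) : nat := epsilon (inhabits 0%N) (quot_dim I t).

Definition separator s (P : 'I_s -> 'rV[k]_n.+1) (m : 'I_s -> nat) (i : 'I_s)
    (F : {mpoly k[n.+1]}) : Prop :=
  [/\ exists d : nat, F \is d.-homog,
      ideal_pow (point_ideal (P i)) (m i - 1) F,
      ~ ideal_pow (point_ideal (P i)) (m i) F
    & forall j, j != i -> ideal_pow (point_ideal (P j)) (m j) F].

(* The classes modulo I of the elements of G generate J / I (where I is
   contained in J); the equivalence also forces these elements to lie in J. *)
Definition generates_mod I J (G : seq {mpoly k[n.+1]}) : Prop :=
  forall f, J f <-> exists a : 'I_(size G) -> {mpoly k[n.+1]},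
    I (f - \sum_(l < size G) a l * G`_l).

Definition minimal_separators s (P : 'I_s -> 'rV[k]_n.+1) (m : 'I_s -> nat)
    (i : 'I_s) (F : seq {mpoly k[n.+1]}) : Prop :=
  let IZ := fat_ideal P m in
  let IZ' := fat_ideal P (lower_mult m i) in
  let nu := (fat_degree m - fat_degree (lower_mult m i))%N in
  [/\ uniq F /\ size F = nu,
      forall f, f \in F -> separator P m i f,
      generates_mod IZ IZ' F
    & forall G, (size G < nu)%N -> ~ generates_mod IZ IZ' G].

(* [deg_Z(P_i) = d] for one choice of the minimal set of separators; [msize f]
   is one more than the degree of [f]. *)
Definition separator_degrees s (P : 'I_s -> 'rV[k]_n.+1) (m : 'I_s -> nat)
    (i : 'I_s) (d : seq nat) : Prop :=
  exists F, minimal_separators P m i F /\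
            d = sort leq [seq (msize f).-1 | f <- F].

Lemma quot_dim_uniq I t d e : quot_dim I t d -> quot_dim I t e -> d = e.
Proof.
have dimP c (phi : 'Hom(dhomog n.+1 k t, 'rV[k]_c)) :
  (forall v, exists f, phi f = v) ->
  (\dim (lker phi) + c)%N = \dim {:dhomog n.+1 k t}.
  move=> sur; rewrite -(limg_ker_dim phi fullv) capfv; congr (_ + _)%N.
  have -> : limg phi = fullv.
    apply/vspaceP => v; rewrite memvf; have [f <-] := sur v.
    by rewrite memv_img ?memvf.
  by rewrite dimvf dim_matrix; apply/esym/mul1n.
move=> [phi [sphi kphi]] [psi [spsi kpsi]].
have E : lker phi = lker psi.
  apply/vspaceP => f; rewrite !memv_ker.
  by apply/eqP/eqP => [/kphi/kpsi | /kpsi/kphi].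
by apply/(@addnI (\dim (lker phi))); rewrite dimP // E dimP.
Qed.

Lemma quot_dim_ex I t :
  I 0 -> (forall (c : k) f g, I f -> I g -> I (c *: f + g)) ->
  exists d, quot_dim I t d.
Proof.
move=> I0 Ilin; pose V : vectType k := dhomog n.+1 k t.
pose sub (U : {vspace V}) := forall f : V, f \in U -> I f.
have [U sU maxU] : exists2 U, sub U & forall f : V, I f -> f \in U.
  have grow N : (exists2 U, sub U & forall f : V, I f -> f \in U) \/
                (exists2 U, sub U & (N <= \dim U)%N).
    elim: N => [|N [|[U sU leU]]]; [right | by move=> ?; left |].
      by exists 0%VS => // f; rewrite memv0 => /eqP ->; rewrite raddf0.
    case: (classic (forall f : V, I f -> f \in U)) => [|nU].
      by left; exists U.
    have [f nf] := not_all_ex_not _ _ nU.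
    have [If /negP fU] : I f /\ ~ f \in U by apply: imply_to_and.
    right; exists (<[f]> + U)%VS => [g /memv_addP[u /vlineP[c ->] [v vU ->]]|].
      by rewrite linearP; apply: Ilin => //; apply: sU.
    rewrite (leq_ltn_trans leU) // ltnNge; apply: contra fU => le.
    have /eqP -> : U == (<[f]> + U)%VS by rewrite eqEdim addvSr.
    by rewrite memvE addvSl.
  have [//|[U sU]] := grow (\dim {:V}).+1.
  by rewrite ltnNge dimvS ?subvf.
pose W := (U^C)%VS.
pose h (f : V) : 'rV[k]_(\dim W) :=
  \row_j coord (vbasis W) j (f - projv U f).
have hlin : linear h.
  move=> c f g; apply/rowP => j; rewrite !mxE -linearP; congr (coord _ _ _).
  by rewrite linearP scalerBr opprD addrACA.
pose hL := GRing.isLinear.Build k V 'rV[k]_(\dim W) _ h hlin.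
pose hh : {linear V -> 'rV[k]_(\dim W)} := HB.pack h hL.
exists (\dim W), (linfun hh); split=> [v|f].
  pose f := \sum_j v 0 j *: (vbasis W)`_j.
  have fW : f \in W.
    apply: memv_suml => j _; apply: memvZ; apply: vbasis_mem.
    by rewrite mem_nth ?size_tuple.
  exists f; rewrite lfunE /=; apply/rowP => j; rewrite mxE.
  have -> : projv U f = 0.
    by apply/eqP; rewrite -memv_ker lker_proj.
  by rewrite subr0 coord_sum_free // (basis_free (vbasisP W)).
rewrite lfunE /=.
have rW : f - projv U f \in W.
  by rewrite /W -lker_proj memv_ker linearB /= (projv_id (memv_proj U f)) subrr.
split=> [h0|If].
  apply: sU; suff -> : f = projv U f by apply: memv_proj.
  apply/eqP; rewrite -subr_eq0 (coord_vbasis rW) big1 // => j _.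
  by move/rowP/(_ j): h0; rewrite !mxE => ->; rewrite scale0r.
by apply/rowP => j; rewrite !mxE projv_id ?maxU // subrr linear0.
Qed.

Lemma fat_ideal_lin s (P : 'I_s -> 'rV[k]_n.+1) m :
  fat_ideal P m 0 /\
  forall (c : k) f g,
    fat_ideal P m f -> fat_ideal P m g -> fat_ideal P m (c *: f + g).
Proof.
split=> [j|c f g If Ig j].
  exists 0%N, (fun _ => 0), (fun _ => 0); split; first by case.
  by rewrite big_ord0.
have [r [a [u [Su ->]]]] := If j; have [q [b [v [Sv ->]]]] := Ig j.
exists (r + q)%N,
  (fun l => match split l with inl x => c *: a x | inr y => b y end),
  (fun l => match split l with inl x => u x | inr y => v y end).
split=> [l|]; first by case: (split l).
rewrite big_split_ord /= scaler_sumr; congr (_ + _); apply: eq_bigr => l _.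
  by rewrite (unsplitK (inl l)) scalerAl.
by rewrite (unsplitK (inr l)).
Qed.

Lemma hilbertP s (P : 'I_s -> 'rV[k]_n.+1) m t d :
  quot_dim (fat_ideal P m) t d <-> hilbert (fat_ideal P m) t = d.
Proof.
have [I0 Ilin] := fat_ideal_lin P m.
have ex := epsilon_spec (inhabits 0%N) _ (quot_dim_ex t I0 Ilin).
by split=> [|<- //]; apply: quot_dim_uniq.
Qed.

End FatPoints.

(* Main.v *)
(** Let G_1, ..., G_n generate the ideal I_X of X = {P_1, ..., P_s}, with
    d_l = deg G_l and sigma = sum_l (d_l - 1).

    Since a form that vanishes on X \ {P_j} but not at P_j carries I_(P_j) into
    I_X, the differentials of the G_l at P_j are independent; comparing leading
    terms along lines through P_j, an element of I_(P_j)^(m+1) of the form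
    sum_(|a| = m) c_a G^a has all its coefficients c_a in I_(P_j).  By induction
    on m, the intersection of the I_(P_j)^m is I_X^m.

    Every P_i has a reduced separator F_i of degree sigma, the determinant of a
    matrix expressing the G_l through the linear forms vanishing at P_i.  None has
    smaller degree: expressing through the G_l the products of hyperplanes
    x_b = v (v running through the b-th coordinates of X), the determinant of the
    transition matrix times a separator vanishes at all points of a grid except
    P_i, which bounds its degree from below.  Hence F_i generates I_(X \ P_i)
    modulo I_X, and the F_i G^a with |a| = m - 1 form a minimal set of separators
    of multiplicity m, of degrees sigma + sum_l d_l a_l independent of i.

    Finally dim (I_Z' / I_Z)_t is the number of separators of degree at most t in
    any minimal set, which gives both the uniqueness of the tuple and the equality
    of Hilbert functions. *)

Require Import Defs.
From mathcomp Require Import all_boot all_order all_algebra.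
From mathcomp Require Import perm.
From Stdlib Require Import Classical ClassicalEpsilon.

Set Implicit Arguments.
Unset Strict Implicit.
Unset Printing Implicit Defensive.

Import GRing.Theory.
Local Open Scope ring_scope.

(** * Ideals and homogeneous polynomials *)

Section Ideals.

Variable R : comNzRingType.
Implicit Types (S I : R -> Prop) (f g : R).

Lemma ideal_gen_ind S (Q : R -> Prop) :
  Q 0 -> (forall a g f, S g -> Q f -> Q (a * g + f)) ->
  forall f, ideal_gen S f -> Q f.
Proof.
move=> Q0 QD f [r [a [g [Sg ->]]]].
by elim/big_rec: _ => // l x _; apply: QD.
Qed.

Lemma ideal_gen0 S : ideal_gen S 0.
Proof.
exists 0%N, (fun _ => 0), (fun _ => 0); split; first by case.
by rewrite big_ord0.
Qed.

Lemma ideal_genMD S a g f : S g -> ideal_gen S f -> ideal_gen S (a * g + f).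
Proof.
move=> Sg [r [b [h [Sh ->]]]].
exists r.+1, (fun l => if unlift ord0 l is Some i then b i else a),
  (fun l => if unlift ord0 l is Some i then h i else g); split.
  by move=> l; case: unliftP.
rewrite big_ord_recl unlift_none; congr (_ + _).
by apply: eq_bigr => i _; rewrite liftK.
Qed.

Lemma ideal_genD S f g : ideal_gen S f -> ideal_gen S g -> ideal_gen S (f + g).
Proof.
move=> Sf Sg; elim/ideal_gen_ind: f / Sf => [|a h f Sh IH]; first by rewrite add0r.
by rewrite -addrA; apply: ideal_genMD.
Qed.

Lemma ideal_genM S f g : ideal_gen S g -> ideal_gen S (f * g).
Proof.
elim/ideal_gen_ind => [|a h u Sh IH]; first by rewrite mulr0; apply: ideal_gen0.
by rewrite mulrDr mulrA; apply: ideal_genMD.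
Qed.

Lemma ideal_genN S f : ideal_gen S f -> ideal_gen S (- f).
Proof. by rewrite -mulN1r; apply: ideal_genM. Qed.

Lemma ideal_gen_mem S f : S f -> ideal_gen S f.
Proof.
move=> Sf; rewrite -[f]mul1r -[1 * f]addr0.
by apply: ideal_genMD => //; apply: ideal_gen0.
Qed.

Lemma ideal_gen_sum S (T : Type) (r : seq T) (D : pred T) (F : T -> R) :
  (forall i, D i -> ideal_gen S (F i)) -> ideal_gen S (\sum_(i <- r | D i) F i).
Proof.
move=> SF; elim/big_ind: _ => //; first exact: ideal_gen0.
exact: ideal_genD.
Qed.

Lemma eq_ideal_gen S S' f : (forall g, S g -> S' g) -> ideal_gen S f -> ideal_gen S' f.
Proof. by move=> SS' [r [a [g [Sg ->]]]]; exists r, a, g; split=> // l; apply: SS'. Qed.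

Lemma ideal_pow_sub I I' m f :
  (forall g, I g -> I' g) -> ideal_pow I m f -> ideal_pow I' m f.
Proof.
move=> II'; apply: eq_ideal_gen => _ [g [Ig ->]].
by exists g; split=> // l; apply: II'.
Qed.

Lemma ideal_pow0 I f : ideal_pow I 0 f.
Proof.
rewrite -[f]mulr1; apply/ideal_genM/ideal_gen_mem.
by exists (fun _ => 0); split; [case | rewrite big_ord0].
Qed.

Lemma ideal_powS I m f g : I f -> ideal_pow I m g -> ideal_pow I m.+1 (f * g).
Proof.
move=> If; elim/ideal_gen_ind => [|a _ u [h [Ih ->]] IH].
  by rewrite mulr0; apply: ideal_gen0.
rewrite mulrDr mulrCA; apply: ideal_genMD => //.
exists (fun l => if unlift ord0 l is Some i then h i else f); split.
  by move=> l; case: unliftP.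
rewrite big_ord_recl unlift_none; congr (_ * _).
by apply: eq_bigr => i _; rewrite liftK.
Qed.

Lemma ideal_pow_lower I m f : ideal_pow I m.+1 f -> ideal_pow I m f.
Proof.
elim/ideal_gen_ind => [|a _ u [h [Ih ->]] IH]; first exact: ideal_gen0.
apply: ideal_genD => //; rewrite big_ord_recl mulrA; apply/ideal_genM/ideal_gen_mem.
by exists (fun l => h (lift ord0 l)).
Qed.

Lemma ideal_powM I a b f g :
  ideal_pow I a f -> ideal_pow I b g -> ideal_pow I (a + b) (f * g).
Proof.
move=> If Ig; elim/ideal_gen_ind: f / If => [|c _ u [h [Ih ->]] IH].
  by rewrite mul0r; apply: ideal_gen0.
rewrite mulrDl -mulrA; apply: ideal_genD => //; apply: ideal_genM.
elim: a h Ih {IH} => [|a IHa] h Ih; first by rewrite big_ord0 mul1r.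
rewrite big_ord_recl -mulrA; apply: ideal_powS => //.
by apply: (IHa (fun l => h (lift ord0 l))) => l; apply: Ih.
Qed.

Lemma ideal_gen_range (r : nat) (G : 'I_r -> R) f :
  ideal_gen (fun g => exists l, g = G l) f <-> exists a, f = \sum_l a l * G l.
Proof.
split=> [|[a ->]]; last first.
  by apply: ideal_gen_sum => l _; apply/ideal_genM/ideal_gen_mem; exists l.
elim/ideal_gen_ind => [|a _ f' [l ->] [b ->]].
  by exists (fun _ => 0); rewrite big1 // => l _; rewrite mul0r.
exists (fun i => (if i == l then a else 0) + b i).
under [RHS]eq_bigr do rewrite mulrDl.
rewrite big_split; congr (_ + _); rewrite (bigD1 l) //= eqxx big1 ?addr0 //.
by move=> i /negPf ->; rewrite mul0r.
Qed.

End Ideals.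

(** * Homogeneous components and evaluation *)

Section Homogeneous.

Variables (R : comNzRingType) (n : nat).
Implicit Types f g a : {mpoly R[n]}.

Lemma pihomogM d e a g : g \is e.-homog ->
  pihomog mdeg d (a * g) = if (e <= d)%N then pihomog mdeg (d - e) a * g else 0.
Proof.
move=> hg; rewrite {1}(pihomog_partitionE (leq_maxl (msize a) d.+1)).
rewrite mulr_suml raddf_sum /=.
have hom c : pihomog mdeg c a * g \is (c + e).-homog.
  by apply: dhomogM => //; apply: pihomogP.
case: leqP => [le|lt].
  have lt' : (d - e < maxn (msize a) d.+1)%N.
    by rewrite (leq_ltn_trans (leq_subr _ _)) // leq_max ltnSn orbT.
  rewrite (bigD1 (Ordinal lt')) //= big1 => [|c neq]; rewrite ?addr0.
    by rewrite pihomog_dE //; have := hom (d - e)%N; rewrite subnK.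
  apply: (pihomog_ne0 _ (hom c)); apply: contra neq => /eqP Ec.
  by apply/eqP/val_inj => /=; rewrite -(addnK e c) Ec.
apply: big1 => c _; apply: (pihomog_ne0 _ (hom c)).
by rewrite neq_ltn (leq_trans lt) ?orbT // leq_addl.
Qed.

(** Only the component of degree [d - e l] of [a l] contributes in degree [d]. Subtraction on [nat]
    truncates, so the clause [b l = 0] records the case [d < e l]. *)
Lemma homog_combination (r d : nat) (e : 'I_r -> nat) f (a g : 'I_r -> {mpoly R[n]}) :
  f \is d.-homog -> (forall l, g l \is (e l).-homog) ->
  f = \sum_l a l * g l ->
  exists b : 'I_r -> {mpoly R[n]},
    (forall l, b l \is (d - e l)%N.-homog /\ ((d < e l)%N -> b l = 0)) /\
    f = \sum_l b l * g l.
Proof.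
move=> hf hg E.
exists (fun l => if (e l <= d)%N then pihomog mdeg (d - e l) (a l) else 0); split.
  by move=> l; case: leqP => _; split=> //; [apply: pihomogP | apply: dhomog0].
rewrite -(pihomog_dE hf) {1}E raddf_sum /=; apply: eq_bigr => l _.
by rewrite (pihomogM _ _ (hg l)); case: ifP => // _; rewrite mul0r.
Qed.

Lemma dhomog_prodE (I : Type) (r : seq I) (D : pred I) (F : I -> {mpoly R[n]})
    (e : I -> nat) :
  (forall i, D i -> F i \is (e i).-homog) ->
  \prod_(i <- r | D i) F i \is (\sum_(i <- r | D i) e i)%N.-homog.
Proof.
move=> h; elim/big_rec2: _ => [|i x y Di hx]; first exact: dhomog1.
by apply: dhomogM => //; apply: h.
Qed.

Lemma meval_homog_scale d f (x : 'I_n -> R) c :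
  f \is d.-homog -> f.@[fun j => c * x j] = c ^+ d * f.@[x].
Proof.
move=> /dhomogP hf; rewrite !mevalE mulr_sumr big_seq [RHS]big_seq.
apply: eq_bigr => m /hf <-; rewrite -[X in c ^+ X]/(mdeg m) mdegE.
rewrite mulrCA; congr (_ * _); rewrite -prodrXr -big_split /=.
by apply: eq_bigr => i _; rewrite exprMn.
Qed.

Lemma meval_scale f (x : 'I_n -> R) c :
  f.@[fun j => c * x j] =
  (\sum_(d < msize f) (pihomog mdeg d f).@[x] *: 'X^d).[c].
Proof.
rewrite {1}(pihomog_partitionE (leqnn (msize f))) raddf_sum horner_sum /=.
apply: eq_bigr => d _; rewrite hornerZ hornerXn mulrC.
by apply: meval_homog_scale; apply: pihomogP.
Qed.

Lemma mpoly_ring_ind (Q : {mpoly R[n]} -> Prop) :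
  (forall c, Q c%:MP) -> (forall i, Q 'X_i) ->
  (forall f g, Q f -> Q g -> Q (f + g)) ->
  (forall f g, Q f -> Q g -> Q (f * g)) -> forall f, Q f.
Proof.
move=> QC QX QD QM f; rewrite [f]mpolyE.
apply: (big_ind Q) => [| |m _]; [by rewrite -mpolyC0 | exact: QD |].
rewrite -mul_mpolyC mpolyXE_id; apply: (QM) => //.
apply: (big_ind Q) => [| |i _]; [by rewrite -mpolyC1 | exact: QM |].
by elim: (m i) => [|j IH]; rewrite ?expr0 -?mpolyC1 // exprS; apply: QM.
Qed.

End Homogeneous.

(** * Reduction to one variable, and polynomials over an infinite field *)

Section Univariate.

Variable R : comNzRingType.

Lemma muni_lift n (j : 'I_n) : muni ('X_(lift ord_max j) : {mpoly R[n.+1]}) = ('X_j)%:P.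
Proof.
rewrite muniE msuppX big_seq1 mcoeffX eqxx scale1r mnm1E lift_eqF expr0 alg_polyC.
congr ('X_[_])%:P; apply/mnmP => i; rewrite mnmE !mnm1E -!val_eqE /=.
by rewrite /bump leqNgt ltn_ord.
Qed.

Lemma muni_max n : muni ('X_ord_max : {mpoly R[n.+1]}) = 'X.
Proof.
rewrite muniE msuppX big_seq1 mcoeffX eqxx scale1r mnm1E eqxx expr1.
rewrite (_ : [multinom _ | i < n] = 0%MM) ?mpolyX0 ?scale1r //.
apply/mnmP => i; rewrite mnmE mnm1E mnm0E -val_eqE /=.
by rewrite eq_sym ltn_eqF.
Qed.

Lemma mwidenXU n (j : 'I_n) : mwiden ('X_j : {mpoly R[n]}) = 'X_(lift ord_max j).
Proof.
rewrite mwidenX mnmwiden1; congr 'X__; apply: val_inj.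
by rewrite /= /bump leqNgt ltn_ord.
Qed.

Lemma muni_inj0 n (f : {mpoly R[n.+1]}) : muni f = 0 -> f = 0.
Proof.
move=> f0; pose phi (p : {poly {mpoly R[n]}}) := (map_poly (@mwiden n R) p).['X_ord_max].
suff <- : phi (muni f) = f by rewrite f0 /phi rmorph0 horner0.
elim/mpoly_ring_ind: f {f0} => [a|i|g h|g h]; rewrite /phi.
- by rewrite muniC map_polyC /= hornerC mwidenC.
- case: (unliftP ord_max i) => [j ->|->].
    by rewrite muni_lift map_polyC hornerC /= mwidenXU.
  by rewrite muni_max map_polyX hornerX.
- by move=> Eg Eh; rewrite muniD (rmorphD (map_poly (@mwiden n R))) hornerD /=;
    congr (_ + _).
- by move=> Eg Eh; rewrite muniM (rmorphM (map_poly (@mwiden n R))) hornerM /=;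
    congr (_ * _).
Qed.

End Univariate.

Section InfiniteField.

Variable k : closedFieldType.

Lemma poly_nonroot (p : {poly k}) : p != 0 -> exists x, p.[x] != 0.
Proof. by move/closed_nonrootP => [x]; exists x. Qed.

(** A nonzero polynomial over an algebraically closed field has a non-root. The factor ['X] keeps
    this non-root away from 0, where nothing is assumed on [p]. *)
Lemma poly_eq0_horner (p : {poly k}) : (forall c, c != 0 -> p.[c] = 0) -> p = 0.
Proof.
move=> p0; apply/eqP; apply: contraT => nz.
have [|x] := @poly_nonroot (p * 'X); first by rewrite mulf_neq0 ?polyX_eq0.
rewrite hornerM hornerX; have [->|/p0 ->] := eqVneq x 0.
  by rewrite mulr0 eqxx.
by rewrite mul0r eqxx.
Qed.

Lemma mpoly_eq0_meval n (f : {mpoly k[n]}) : (forall x, f.@[x] = 0) -> f = 0.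
Proof.
elim: n f => [|n IH] f f0.
  rewrite (nvar0_mpolyC f); have := f0 (fun _ => 0).
  by rewrite {1}(nvar0_mpolyC f) mevalC => ->; rewrite mpolyC0.
have evE x c : f.@[fun i => if unlift ord_max i is Some j then x j else c] =
    (map_poly (meval x) (muni f)).[c].
  elim/mpoly_ring_ind: f {f0} => [a|i|g h|g h].
  - by rewrite mevalC muniC map_polyC /= mevalC hornerC.
  - rewrite mevalXU; case: unliftP => [j ->|->].
      by rewrite muni_lift map_polyC hornerC /= mevalXU.
    by rewrite muni_max map_polyX hornerX.
  - by move=> Eg Eh; rewrite mevalD muniD (rmorphD (map_poly (meval x))) hornerD /= Eg Eh.
  - by move=> Eg Eh; rewrite mevalM muniM (rmorphM (map_poly (meval x))) hornerM /= Eg Eh.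
apply: muni_inj0; apply/polyP => j; rewrite coef0; apply: IH => x.
have : map_poly (meval x) (muni f) = 0.
  by apply: poly_eq0_horner => c _; rewrite -evE f0.
by move/polyP/(_ j); rewrite coef_map coef0.
Qed.

End InfiniteField.

(** * Ideals of points *)

Section PointIdeals.

Variables (k : closedFieldType) (n : nat).
Implicit Types (f g : {mpoly k[n.+1]}) (p w : 'rV[k]_n.+1).

(** The ideal is generated by forms, hence homogeneous, so membership is read on each homogeneous
    component. *)
Lemma vanishing_idealP (X : 'rV[k]_n.+1 -> Prop) f :
  vanishing_ideal X f <-> forall p, X p -> forall d, (pihomog mdeg d f).@[p 0] = 0.
Proof.
split=> [|h]; last first.
  rewrite [f](pihomog_partitionE (leqnn (msize f))); apply: ideal_gen_sum => d _.
  apply: ideal_gen_mem; split=> [|p Xp]; last exact: h.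
  by exists (val d); apply: pihomogP.
elim/ideal_gen_ind => [p _ d|a g f' [[e hg] g0] IH p Xp d].
  by rewrite pihomog0 meval0.
rewrite pihomogD mevalD IH // addr0 (pihomogM _ _ hg).
by case: ifP => _; rewrite ?meval0 // mevalM g0 ?mulr0.
Qed.

Lemma point_idealP p f :
  point_ideal p f <-> forall d, (pihomog mdeg d f).@[p 0] = 0.
Proof.
rewrite /point_ideal vanishing_idealP; split=> [h|h _ ->] //.
exact: h.
Qed.

Lemma vanishing_ideal_point (X : 'rV[k]_n.+1 -> Prop) f :
  vanishing_ideal X f <-> forall p, X p -> point_ideal p f.
Proof.
by rewrite vanishing_idealP; split=> h p Xp; apply/point_idealP; apply: h.
Qed.

Lemma point_ideal_homog p d f : f \is d.-homog -> point_ideal p f <-> f.@[p 0] = 0.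
Proof.
move=> hf; rewrite point_idealP; split=> [/(_ d)|f0 e]; first by rewrite pihomog_dE.
have [<-|ne] := eqVneq d e; first by rewrite pihomog_dE.
by rewrite (pihomog_ne0 ne hf) meval0.
Qed.

Lemma point_idealD p f g : point_ideal p f -> point_ideal p g -> point_ideal p (f + g).
Proof. exact: ideal_genD. Qed.

Lemma point_idealM p f g : point_ideal p g -> point_ideal p (f * g).
Proof. exact: ideal_genM. Qed.

Lemma point_ideal_eval p f : point_ideal p f -> f.@[p 0] = 0.
Proof.
move/point_idealP => h; rewrite (pihomog_partitionE (leqnn (msize f))).
by rewrite raddf_sum big1 // => d _; apply: h.
Qed.

Lemma eval_scale p c f : f.@[(c *: p) 0] = f.@[fun j => c * p 0 j].
Proof. by apply: meval_eq => j; rewrite mxE. Qed.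

(** By [meval_scale], the value of [f] at [c *: p] is a polynomial in [c] whose coefficients are the
    values at [p] of the components of [f]; it has infinitely many zeros. *)
Lemma point_ideal_line p f :
  (forall c, c != 0 -> f.@[(c *: p) 0] = 0) -> point_ideal p f.
Proof.
move=> h; apply/point_idealP => d.
have [lt|ge] := ltnP d (msize f); last first.
  rewrite pihomogE big_seq_cond big_pred0 ?meval0 // => m.
  by apply: contraTF ge => /andP[/msize_mdeg_lt lt /eqP <-]; rewrite -ltnNge.
have : \sum_(i < msize f) (pihomog mdeg i f).@[p 0] *: 'X^i = 0.
  by apply: poly_eq0_horner => c nzc; rewrite -meval_scale -eval_scale h.
move/polyP/(_ d); rewrite coef_sumMXn coef0 /=.
by rewrite (big_pred1 (Ordinal lt)) // => i; rewrite -val_eqE.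
Qed.

Lemma point_ideal_scale p c f : c != 0 -> point_ideal (c *: p) f <-> point_ideal p f.
Proof.
suff imp q a : a != 0 -> point_ideal q f -> point_ideal (a *: q) f.
  move=> nzc; split; last exact: imp.
  by move/(imp _ c^-1); rewrite scalerA mulVf ?scale1r // invr_eq0; apply.
move=> nza /point_idealP h; apply/point_idealP => d.
by rewrite eval_scale (meval_homog_scale _ _ (pihomogP _ _ _)) h mulr0.
Qed.

Definition along p w f : {poly k} :=
  mmap (@polyC k) (fun j => (p 0 j)%:P + w 0 j *: 'X) f.

Lemma alongC p w c : along p w c%:MP = c%:P.
Proof. exact: mmapC. Qed.

Lemma alongX p w j : along p w 'X_j = (p 0 j)%:P + w 0 j *: 'X.
Proof. by rewrite /along mmapX mmap1U. Qed.

Lemma alongD p w f g : along p w (f + g) = along p w f + along p w g.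
Proof. exact: mmapD. Qed.

Lemma alongM p w f g : along p w (f * g) = along p w f * along p w g.
Proof. exact: (rmorphM (mmap (@polyC k) _)). Qed.

Lemma along0 p w f : (along p w f)`_0 = f.@[p 0].
Proof.
elim/mpoly_ring_ind: f => [c|j|f g Ef Eg|f g Ef Eg].
- by rewrite alongC mevalC coefC.
- by rewrite alongX mevalXU coefD coefC coefZ coefX mulr0 addr0.
- by rewrite alongD mevalD coefD Ef Eg.
- by rewrite alongM mevalM coef0M Ef Eg.
Qed.

(** The derivative of [f] at [p] in the direction [w]. *)
Definition dder p w f : k := (along p w f)`_1.

Lemma dderM p w f g : dder p w (f * g) = f.@[p 0] * dder p w g + dder p w f * g.@[p 0].
Proof.
rewrite /dder alongM coefM big_ord_recl big_ord1 /= !along0.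
by [].
Qed.

Lemma dderD p w f g : dder p w (f + g) = dder p w f + dder p w g.
Proof. by rewrite /dder alongD coefD. Qed.

Lemma dderX p w j : dder p w 'X_j = w 0 j.
Proof. by rewrite /dder alongX coefD coefC coefZ coefX mulr1 add0r. Qed.

Lemma dderC p w c : dder p w c%:MP = 0.
Proof. by rewrite /dder alongC coefC. Qed.

Lemma dderZ p w c f : dder p w (c *: f) = c * dder p w f.
Proof. by rewrite -mul_mpolyC dderM mevalC dderC mul0r addr0. Qed.

Lemma dder_sum p w (I : Type) (r : seq I) (D : pred I) (F : I -> {mpoly k[n.+1]}) :
  dder p w (\sum_(i <- r | D i) F i) = \sum_(i <- r | D i) dder p w (F i).
Proof.
by apply: (big_morph (dder p w) (dderD p w)); rewrite -mpolyC0 dderC.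
Qed.

Lemma dder_coord p w f : dder p w f = \sum_j w 0 j * dder p (delta_mx 0 j) f.
Proof.
elim/mpoly_ring_ind: f => [c|j|f g Ef Eg|f g Ef Eg].
- by rewrite dderC big1 // => j _; rewrite dderC mulr0.
- rewrite dderX (bigD1 j) //= dderX mxE !eqxx mulr1 big1 ?addr0 // => i ne.
  by rewrite dderX mxE eqxx eq_sym (negPf ne) mulr0.
- by rewrite dderD Ef Eg -big_split; apply: eq_bigr => j _; rewrite dderD mulrDr.
- rewrite dderM Ef Eg mulr_sumr mulr_suml -big_split; apply: eq_bigr => j _.
  by rewrite /= dderM mulrDr mulrA; congr (_ + _); rewrite -?mulrA // mulrCA.
Qed.

(** Each factor in the ideal of [p] vanishes at the parameter 0 of the line, so it contributes one
    factor ['X]. *)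
Lemma along_pow p w m f :
  ideal_pow (point_ideal p) m f -> exists q, along p w f = q * 'X^m.
Proof.
elim/ideal_gen_ind => [|a _ f' [h [Ih ->]] [q E]].
  by exists 0; rewrite mul0r -mpolyC0 alongC.
have [b Eb] : exists b, along p w (\prod_l h l) = b * 'X^m.
  elim: m h Ih {E} => [|m IH] h Ih; first by eexists; rewrite mulr1.
  rewrite big_ord_recl alongM.
  have [|b ->] := IH (fun l => h (lift ord0 l)); first by move=> l; apply: Ih.
  have : root (along p w (h ord0)) 0.
    by rewrite rootE horner_coef0 along0 (point_ideal_eval (Ih _)).
  case/factor_theorem => c; rewrite subr0 => ->.
  by exists (c * b); rewrite exprS !mulrA (mulrAC c).
by exists (along p w a * b + q); rewrite alongD alongM E Eb mulrDl mulrA.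
Qed.

(** Nonproportional rows have a nonzero minor [p_i q_j - p_j q_i]; the form is this minor with [q]
    replaced by the variables. *)
Lemma exists_separating_form p q : p != 0 -> (forall c, q <> c *: p) ->
  exists f, [/\ f \is 1.-homog, f.@[p 0] = 0 & f.@[q 0] != 0].
Proof.
move=> /rV0Pn[i nz] nq.
have [j nj] : exists j, p 0 i * q 0 j != p 0 j * q 0 i.
  apply/existsP; apply: contraT; rewrite negb_exists => /forallP h.
  case: (nq (q 0 i / p 0 i)); apply/rowP => j; rewrite mxE.
  have /eqP := negPn (h j); rewrite [_ / _ * _]mulrAC => E.
  by rewrite [q 0 i * _]mulrC -E mulrAC mulfV // mul1r.
have hX l : ('X_l : {mpoly k[n.+1]}) \is 1.-homog by rewrite dhomogX; apply/eqP/mdeg1.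
exists (p 0 i *: 'X_j - p 0 j *: 'X_i); split.
- by apply: rpredB; apply: rpredZ.
- by rewrite mevalB !mevalZ !mevalXU mulrC subrr.
- by rewrite mevalB !mevalZ !mevalXU subr_eq0.
Qed.

End PointIdeals.

(** * Powers of the ideal of a complete intersection *)

Section Jacobian.

Variables (k : closedFieldType) (n s : nat) (P : 'I_s -> 'rV[k]_n.+1).
Variable G : 'I_n -> {mpoly k[n.+1]}.
Hypothesis hP : distinct_points P.
Hypothesis hI : forall f, (forall i, point_ideal (P i) f) <->
  ideal_gen (fun g => exists l, g = G l) f.

Lemma dder_linear_form (p w : 'rV[k]_n.+1) f : f \is 1.-homog -> dder p w f = f.@[w 0].
Proof.
move=> /dhomogP hf; rewrite [f in LHS]mpolyE [f in RHS]mpolyE dder_sum raddf_sum.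
rewrite big_seq [RHS]big_seq; apply: eq_bigr => m /hf /eqP /mdeg1P[j /eqP ->].
by rewrite dderZ dderX /= mevalZ mevalXU.
Qed.

Lemma exists_avoiding_form (D : pred 'I_s) (q : 'rV[k]_n.+1) :
  (forall j, D j -> forall c, q <> c *: P j) ->
  exists e A, [/\ A \is e.-homog, A.@[q 0] != 0 & forall j, D j -> A.@[P j 0] = 0].
Proof.
move=> hD.
have /fin_all_exists[f hf] j : exists f : {mpoly k[n.+1]},
    [/\ f \is (D j : nat).-homog, f.@[q 0] != 0 & D j -> f.@[P j 0] = 0].
  case Dj: (D j); last by exists 1; split; rewrite ?dhomog1 ?meval1 ?oner_eq0.
  by have [f [h1 h2 h3]] := exists_separating_form (hP.1 j) (hD j Dj); exists f.
exists (\sum_j D j)%N, (\prod_j f j); split.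
- by apply: dhomog_prodE => j _; case: (hf j).
- by rewrite rmorph_prod; apply/prodf_neq0 => j _; case: (hf j).
- move=> j Dj; rewrite rmorph_prod (bigD1 j) //=.
  by have [_ _ ->] := hf j; rewrite ?mul0r.
Qed.

Lemma exists_reduced_separator i :
  exists e A, [/\ A \is e.-homog, A.@[P i 0] != 0 & forall j, j != i -> A.@[P j 0] = 0].
Proof.
have [|e [A [h1 h2 h3]]] := @exists_avoiding_form (fun j => j != i) (P i).
  by move=> j ne c; apply: hP.2 => //.
by exists e, A.
Qed.

Lemma generator_point_ideal i l : point_ideal (P i) (G l).
Proof. by move: i; apply/hI/ideal_gen_mem; exists l. Qed.

Lemma generator_eval i l : (G l).@[P i 0] = 0.
Proof. exact/point_ideal_eval/generator_point_ideal. Qed.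

(** The Jacobian matrix [J] has n + 1 rows and n columns, and its left kernel lies on the line of
    [P i]; hence its rank is n. *)
Lemma jacobian_surjective i (z : 'I_n -> k) :
  exists w : 'rV[k]_n.+1, forall l, dder (P i) w (G l) = z l.
Proof.
pose J : 'M[k]_(n.+1, n) := \matrix_(j, l) dder (P i) (delta_mx 0 j) (G l).
have JE w l : (w *m J) 0 l = dder (P i) w (G l).
  by rewrite mxE dder_coord; apply: eq_bigr => j _; rewrite mxE.
have kerJ : (kermx J <= P i)%MS.
  apply/rV_subP => v /sub_kermxP vJ.
  apply: NNPP => /negP nv.
  (* For [v] off the line of [P i], the form [A * f] lies in I_X, so its derivative along [v]
     vanishes with those of the [G l]; but this derivative is A(P_i) f(v), which is nonzero. *)
  have [|f [hf fP fv]] := exists_separating_form (q := v) (hP.1 i).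
    by move=> c E; move: nv; rewrite E scalemx_sub.
  have [e [A [hA AP A0]]] := exists_reduced_separator i.
  have /hI/ideal_gen_range[b E] : forall j, point_ideal (P j) (A * f).
    move=> j; apply/(point_ideal_homog _ (dhomogM hA hf)); rewrite mevalM.
    by have [->|/A0->] := eqVneq j i; rewrite ?mul0r // fP mulr0.
  have /eqP : dder (P i) v (A * f) = 0.
    rewrite E dder_sum big1 // => l _.
    by rewrite dderM generator_eval mulr0 addr0 -JE vJ mxE mulr0.
  rewrite dderM fP mulr0 addr0 dder_linear_form // mulf_eq0.
  by rewrite (negPf AP) (negPf fv).
have full : row_full J.
  rewrite /row_full eqn_leq rank_leq_col /=.
  have := leq_trans (mxrankS kerJ) (rank_leq_row _).
  by rewrite mxrank_ker leq_subLR addn1.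
have [w E] := submxP (submx_full (\row_l z l) full).
by exists w => l; rewrite -JE -E mxE.
Qed.

(** Along a direction [w] in which the [G l] have derivatives [z l], one has G_l = t g_l with g_l(0)
    = z_l. Cancelling t^m leaves the sum of the A_a g^a divisible by t, so the form with
    coefficients A_a(P_i) vanishes at [z], which is arbitrary. *)
Lemma map_coef_eval0 i m (A : {mpoly {mpoly k[n.+1]}[n]}) :
  A \is m.-homog -> ideal_pow (point_ideal (P i)) m.+1 A.@[G] ->
  map_mpoly (meval (P i 0)) A = 0.
Proof.
move=> /dhomogP hA hpow; apply: mpoly_eq0_meval => z.
have [w hw] := jacobian_surjective i z.
have [q Eq] := along_pow w hpow.
have /fin_all_exists[g hg] l : exists g, along (P i) w (G l) = g * 'X.
  have : root (along (P i) w (G l)) 0 by rewrite rootE horner_coef0 along0 generator_eval.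
  by case/factor_theorem => c; rewrite subr0; exists c.
have g0 l : (g l)`_0 = z l by rewrite -hw /dder hg coefMX.
have E : \sum_(a <- msupp A) along (P i) w A@_a * \prod_l g l ^+ a l = q * 'X.
  apply: (mulIf (_ : 'X^m != 0)); first by rewrite -size_poly_eq0 size_polyXn.
  rewrite -mulrA -exprS -Eq mevalE.
  rewrite (big_morph _ (alongD _ _) (_ : along _ _ 0 = 0)); last by rewrite -mpolyC0 alongC.
  rewrite mulr_suml big_seq [RHS]big_seq; apply: eq_bigr => a /hA ha.
  rewrite alongM -mulrA; congr (_ * _).
  rewrite (big_morph _ (alongM _ _) (_ : along _ _ 1 = 1)); last by rewrite -mpolyC1 alongC.
  rewrite -ha -[X in 'X^X]/(mdeg a) mdegE -prodrXr -big_split /=.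
  apply: eq_bigr => l _; rewrite -exprMn -hg.
  elim: (a l) => [|c IH]; first by rewrite !expr0 -mpolyC1 alongC.
  by rewrite !exprS alongM IH.
have /(congr1 (fun p : {poly k} => p`_0)) := E; rewrite coefMX /= => <-.
rewrite coef_sum /map_mpoly /mmap raddf_sum; apply: eq_bigr => a _.
rewrite /= mevalM mevalC -horner_coef0 hornerM horner_coef0 along0; congr (_ * _).
rewrite horner_prod /mmap1 rmorph_prod; apply: eq_bigr => l _.
by rewrite horner_exp horner_coef0 g0 rmorphXn /= mevalXU.
Qed.

End Jacobian.

Section SymbolicPowers.

Variables (k : closedFieldType) (n s : nat) (P : 'I_s -> 'rV[k]_n.+1).
Variable G : 'I_n -> {mpoly k[n.+1]}.
Hypothesis hP : distinct_points P.
Hypothesis hI : forall f, (forall i, point_ideal (P i) f) <->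
  ideal_gen (fun g => exists l, g = G l) f.
Implicit Types (A : {mpoly {mpoly k[n.+1]}[n]}) (f : {mpoly k[n.+1]}).

(** The coefficients of [A] may be inhomogeneous, so vanishing at one representative is not yet
    membership. [map_coef_eval0] is therefore applied to the rows [c *: P j] for every nonzero [c];
    they define the same ideals. *)
Lemma coef_point_ideal i m A : A \is m.-homog ->
  ideal_pow (point_ideal (P i)) m.+1 A.@[G] -> forall a, point_ideal (P i) A@_a.
Proof.
move=> hA hpow a; apply: point_ideal_line => c nzc.
have E0 j f : point_ideal (c *: P j) f <-> point_ideal (P j) f by apply: point_ideal_scale.
have dP : distinct_points (fun j => c *: P j).
  split=> [j|j l ne b]; first by rewrite scaler_eq0 negb_or nzc hP.1.
  move=> /(congr1 (fun v => c^-1 *: v)); rewrite !scalerA mulVf // scale1r.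
  exact: hP.2.
have cI f : (forall j, point_ideal (c *: P j) f) <->
    ideal_gen (fun g => exists l, g = G l) f.
  by rewrite -hI; split=> h j; apply/E0; apply: h.
have := map_coef_eval0 (i := i) dP cI hA; rewrite -mcoeff_map_mpoly => -> //.
  by rewrite mcoeff0.
by apply: ideal_pow_sub hpow => g /E0.
Qed.

Lemma meval_ideal_pow (I : {mpoly k[n.+1]} -> Prop) e m A : A \is m.-homog ->
  (forall l, I (G l)) -> (forall a, ideal_pow I e A@_a) ->
  ideal_pow I (e + m) A.@[G].
Proof.
move=> /dhomogP hA IG IA; rewrite mevalE big_seq; apply: ideal_gen_sum => a /hA <-.
apply: ideal_powM => //; rewrite -[Measure.sort _ _]/(mdeg a) mdegE.
apply: (big_rec2 (fun x y => ideal_pow I x y)) => [|l x y _ Iy].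
  exact: ideal_pow0.
apply: ideal_powM => //; elim: (a l) => [|c IH]; first exact: ideal_pow0.
by rewrite exprS; apply: ideal_powS.
Qed.

Lemma meval_point_ideal_pow i m A : A \is m.-homog ->
  ideal_pow (point_ideal (P i)) m A.@[G].
Proof.
move=> hA; apply: (@meval_ideal_pow _ 0) => // [l|a]; last exact: ideal_pow0.
by apply: (generator_point_ideal hI).
Qed.

Lemma meval_point_ideal_powS i m A : A \is m.-homog ->
  (forall a, point_ideal (P i) A@_a) -> ideal_pow (point_ideal (P i)) m.+1 A.@[G].
Proof.
move=> hA IA; apply: (@meval_ideal_pow _ 1) => // [l|a].
  by apply: (generator_point_ideal hI).
by rewrite -[A@_a]mulr1; apply: ideal_powS => //; apply: ideal_pow0.
Qed.

(** Elements of I_X^m are encoded as values at [G] of forms of degree m over the coordinate ring. In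
    the induction step the coefficients of [A] lie in every point ideal, hence in I_X; writing each
    as a linear form in [G] raises the degree by one. *)
Lemma symbolic_power m f : (forall i, ideal_pow (point_ideal (P i)) m f) ->
  exists2 A, A \is m.-homog & f = A.@[G].
Proof.
elim: m f => [|m IH] f hf.
  by exists f%:MP; rewrite ?mevalC // dhomogE msuppC; case: eqP => //= _; rewrite mdeg0.
have [|A hA E] := IH f; first by move=> i; apply/ideal_pow_lower/hf.
have IA a : exists2 B : {mpoly {mpoly k[n.+1]}[n]}, B \is 1.-homog & A@_a = B.@[G].
  have /hI/ideal_gen_range[b ->] : forall i, point_ideal (P i) A@_a.
    by move=> i; apply: (coef_point_ideal hA); rewrite -E.
  exists (\sum_l b l *: 'X_l).
    by apply: rpred_sum => l _; apply: rpredZ; rewrite dhomogX; apply/eqP/mdeg1.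
  by rewrite raddf_sum; apply: eq_bigr => l _; rewrite /= mevalZ mevalXU.
rewrite E mevalE; move/dhomogP: hA => hA; rewrite big_seq.
apply: (big_ind (fun g => exists2 A, A \is m.+1.-homog & g = A.@[G])).
- by exists 0; [apply: rpred0 | rewrite meval0].
- by move=> x y [B hB ->] [C hC ->]; exists (B + C); [apply: rpredD | rewrite mevalD].
- move=> a /hA ha; have [B hB ->] := IA a; exists (B * 'X_[a]).
    by apply: (dhomogM hB (e := m)); rewrite dhomogX; apply/eqP.
  by rewrite mevalM mevalX.
Qed.

End SymbolicPowers.

(** * Reduced separators *)

(** With p_c nonzero, the forms are X_j - (p_j / p_c) X_c for j distinct from c. Modulo them every
    polynomial becomes a polynomial [u] in X_c alone. *)
Lemma point_ideal_linear_generators (k : closedFieldType) (n : nat) (p : 'rV[k]_n.+1) :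
  p != 0 -> exists L : 'I_n -> {mpoly k[n.+1]},
  [/\ forall b, L b \is 1.-homog, forall b, (L b).@[p 0] = 0,
      forall f, point_ideal p f -> exists M, f = \sum_b M b * L b
    & forall q : 'rV[k]_n.+1, (forall b, (L b).@[q 0] = 0) -> exists c, q = c *: p].
Proof.
move=> /rV0Pn[c nz].
pose L b : {mpoly k[n.+1]} := 'X_(lift c b) - (p 0 (lift c b) / p 0 c) *: 'X_c.
have LE b (q : 'rV[k]_n.+1) :
    (L b).@[q 0] = q 0 (lift c b) - p 0 (lift c b) / p 0 c * q 0 c.
  by rewrite mevalB mevalZ !mevalXU.
have L0 b : (L b).@[p 0] = 0 by rewrite LE mulfVK // subrr.
have hL b : L b \is 1.-homog.
  have hX j : ('X_j : {mpoly k[n.+1]}) \is 1.-homog by rewrite dhomogX; apply/eqP/mdeg1.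
  by apply: rpredB => //; apply: rpredZ.
exists L; split=> // [f hf|q hq].
- pose ev (u : {poly k}) : {mpoly k[n.+1]} := (map_poly (@mpolyC n.+1 k) u).['X_c].
  have evD u v : ev (u + v) = ev u + ev v.
    by rewrite /ev (rmorphD (map_poly (@mpolyC n.+1 k))) hornerD.
  have evM u v : ev (u * v) = ev u * ev v.
    by rewrite /ev (rmorphM (map_poly (@mpolyC n.+1 k))) hornerM.
  have [u hu] : exists u, ideal_gen (fun g => exists b, g = L b) (f - ev u).
    elim/mpoly_ring_ind: f {hf} => [a|j|f g [u hu] [v hv]|f g [u hu] [v hv]].
    + by exists a%:P; rewrite /ev map_polyC hornerC /= subrr; apply: ideal_gen0.
    + case: (unliftP c j) => [b ->|->].
        exists ((p 0 (lift c b) / p 0 c)%:P * 'X).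
        rewrite evM /ev map_polyC map_polyX hornerC hornerX /= mul_mpolyC.
        by apply: ideal_gen_mem; exists b.
      by exists 'X; rewrite /ev map_polyX hornerX subrr; apply: ideal_gen0.
    + by exists (u + v); rewrite evD opprD addrACA; apply: ideal_genD.
    + exists (u * v); rewrite evM.
      rewrite (_ : _ - _ = f * (g - ev v) + ev v * (f - ev u)).
        by apply: ideal_genD; apply: ideal_genM.
      by rewrite !mulrBr addrA (mulrC f (ev v)) subrK (mulrC (ev v) (ev u)).
  have [b Eb] := (ideal_gen_range _ _).1 hu.
  suff u0 : u = 0.
    exists b; rewrite -Eb u0 /ev (rmorph0 (map_poly (@mpolyC n.+1 k))) horner0.
    by rewrite subr0.
  (* At the multiple of [p] whose coordinate [c] is [a], both [f] and the [L b] vanish, which leaves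
     u(a) = 0. *)
  apply: poly_eq0_horner => a nza.
  have := congr1 (meval (((a / p 0 c) *: p) 0)) Eb.
  have fa : f.@[((a / p 0 c) *: p) 0] = 0.
    apply: point_ideal_eval; apply/point_ideal_scale => //.
    by rewrite mulf_neq0 ?invr_eq0.
  have -> : (\sum_i b i * L i).@[((a / p 0 c) *: p) 0] = 0.
    rewrite raddf_sum big1 // => i _; rewrite /= mevalM (eval_scale _ _ (L i)).
    by rewrite (meval_homog_scale _ _ (hL i)) L0 !mulr0.
  rewrite mevalB fa sub0r.
  have -> : (ev u).@[((a / p 0 c) *: p) 0] = u.[a].
    elim/poly_ind: u {hu Eb} => [|u e IH].
      by rewrite /ev rmorph0 !horner0 meval0.
    rewrite evD evM /ev map_polyX map_polyC hornerX hornerC -/(ev u) /=.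
    by rewrite mevalD mevalM mevalXU mevalC IH hornerMXaddC mxE mulfVK.
  by move/eqP; rewrite oppr_eq0 => /eqP.
- exists (q 0 c / p 0 c); apply/rowP => j; rewrite mxE.
  case: (unliftP c j) => [b ->|->]; last by rewrite mulfVK.
  by have /eqP := hq b; rewrite LE subr_eq0 => /eqP ->;
    rewrite mulrAC [RHS]mulrAC (mulrC (q 0 c)).
Qed.

Section Separators.

Variables (k : closedFieldType) (n s : nat) (P : 'I_s -> 'rV[k]_n.+1).
Variables (G : 'I_n -> {mpoly k[n.+1]}) (d : 'I_n -> nat).
Hypothesis hP : distinct_points P.
Hypothesis hG : forall l, G l \is (d l).-homog.
Hypothesis hI : forall f, (forall i, point_ideal (P i) f) <->
  ideal_gen (fun g => exists l, g = G l) f.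

(** A form of degree 0 vanishing at [P i] is zero, whereas [jacobian_surjective] gives [G l] a
    nonzero derivative there. *)
Lemma generator_degree_gt0 (i : 'I_s) l : (0 < d l)%N.
Proof.
rewrite lt0n; apply/eqP => d0.
have [w /(_ l)] := jacobian_surjective hP hI i (fun _ => 1).
have := generator_eval hI i l; have := hG l; rewrite d0 => /dhomogP h0.
have -> : G l = ((G l)@_0)%:MP.
  apply: msize1_polyC; rewrite msizeE; apply/bigmax_leqP_seq => m /h0 + _.
  by rewrite -[Measure.sort _ _]/(mdeg m) => ->.
rewrite mevalC => ->; rewrite mpolyC0 -mpolyC0 dderC => /esym/eqP.
by rewrite oner_eq0.
Qed.

Lemma det_homog (M : 'M[{mpoly k[n.+1]}]_n) (e : 'I_n -> nat) :
  (forall l b, M l b \is (e l).-homog) -> \det M \is (\sum_l e l)%N.-homog.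
Proof.
move=> hM; apply: rpred_sum => u _; rewrite rpredMsign.
by apply: dhomog_prodE => l _.
Qed.

(* Writing G = M L with L the linear forms through P_i, Cramer's rule makes det M
   vanish at the other points, while M is the Jacobian matrix at P_i. *)
Lemma exists_separator_sigma i :
  exists F, [/\ F \is (\sum_l (d l).-1)%N.-homog, F.@[P i 0] != 0
    & forall j, j != i -> F.@[P j 0] = 0].
Proof.
have [L [hL L0 Lgen Lq]] := point_ideal_linear_generators (hP.1 i).
have /fin_all_exists[M hM] l : exists M : 'I_n -> {mpoly k[n.+1]},
    (forall b, M b \is (d l).-1.-homog) /\ G l = \sum_b M b * L b.
  have [a Ea] := Lgen _ (generator_point_ideal hI i l).
  have [b [hb Eb]] := homog_combination (hG l) hL Ea.
  by exists b; split=> // c; rewrite -subn1; case: (hb c).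
pose MM : 'M[{mpoly k[n.+1]}]_n := \matrix_(l, b) M l b.
pose ME (q : 'rV[k]_n.+1) : 'M[k]_n := \matrix_(l, b) (M l b).@[q 0].
have detE (q : 'rV[k]_n.+1) : (\det MM).@[q 0] = \det (ME q).
  rewrite -det_map_mx; congr (\det _); apply/matrixP => l b.
  by rewrite !mxE.
exists (\det MM); split.
- by apply: det_homog => l b; rewrite mxE; case: (hM l).
(* The [L b] vanish at [P i], so there the derivatives of the [G l] are M times those of the [L b]:
   a left kernel vector of M would be a relation between independent differentials. *)
- rewrite detE; apply/negP => /det0P[v nzv vM].
  have [l0 nz] := rV0Pn _ nzv.
  have [w hw] := jacobian_surjective hP hI i (fun l => (l == l0)%:R).
  have : \sum_l v 0 l * dder (P i) w (G l) = 0.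
    transitivity (\sum_b (v *m ME (P i)) 0 b * dder (P i) w (L b)).
      under [RHS]eq_bigr do rewrite mxE mulr_suml.
      rewrite exchange_big; apply: eq_bigr => l _.
      have [_ ->] := hM l; rewrite dder_sum mulr_sumr; apply: eq_bigr => b _.
      by rewrite dderM L0 mulr0 addr0 mxE mulrA.
    by rewrite vM big1 // => b _; rewrite mxE mul0r.
  rewrite (bigD1 l0) //= hw eqxx mulr1 big1 ?addr0 => [/eqP|l /negPf ne].
    by rewrite (negPf nz).
  by rewrite hw ne mulr0.
(* G = M L vanishes at [P j], so the values of the [L b] form a kernel vector; it is nonzero because
   the common zeros of the [L b] are multiples of [P i]. *)
- move=> j ne; rewrite detE -det_tr; apply/eqP/det0P.
  exists (\row_b (L b).@[P j 0]).
    apply/negP => /eqP /rowP h; have [c] : exists c, P j = c *: P i.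
      by apply: Lq => b; have := h b; rewrite !mxE.
    by apply: hP.2; rewrite eq_sym.
  apply/rowP => l; rewrite !mxE -[RHS](generator_eval hI j l).
  have [_ ->] := hM l; rewrite raddf_sum; apply: eq_bigr => b _.
  by rewrite !mxE /= mevalM mulrC.
Qed.

End Separators.

(** * Polynomials vanishing on a grid except at one point *)

Section Grid.

Variable k : fieldType.

(* The weights of the divided difference at the nodes V. *)
Lemma exists_annihilating_weights (V : seq k) : uniq V ->
  exists w : 'I_(size V) -> k, (forall j, w j != 0) /\
    forall q, (q.+1 < size V)%N -> \sum_j w j * V`_j ^+ q = 0.
Proof.
move=> uV; pose N := size V.
pose p (j : 'I_N) : {poly k} := \prod_(i <- enum (predC1 j)) ('X - (V`_i)%:P).
have sp j : size (p j) = N.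
  rewrite size_prod_XsubC -cardE cardC1 card_ord prednK //.
  by rewrite (leq_trans _ (ltn_ord j)).
have p0 i j : (i != j) = ((p j).[V`_i] == 0).
  rewrite horner_prod prodf_seq_eq0; apply/idP/hasP => [ne|[l]].
    by exists i; rewrite ?mem_enum ?inE //= hornerXsubC subrr.
  rewrite mem_enum inE /= hornerXsubC subr_eq0 => ne /eqP /(uniqP 0 uV) E.
  by apply: contraNneq ne => <-; rewrite -val_eqE /= E ?inE.
exists (fun j => (p j).[V`_j]^-1); split=> [j|q lt].
  by rewrite invr_eq0 -p0 negbK.
(* [D] is X^q minus its Lagrange interpolant at [V]: its degree is less than [N] and it has [N]
   roots. *)
pose D := 'X^q - \sum_j ((p j).[V`_j]^-1 * V`_j ^+ q) *: p j.
have D0 : D = 0.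
  apply/eqP; apply: contraT => nz.
  have : all (root D) V.
    apply/(all_nthP 0) => i lti; pose i' := Ordinal (lti : (i < N)%N).
    rewrite rootE hornerD hornerN hornerXn horner_sum (bigD1 i') //= hornerZ.
    rewrite big1 ?addr0 => [|j ne].
      by rewrite mulrAC mulVf ?mul1r ?subrr // -[i]/(val i') -p0 negbK.
    rewrite hornerZ (_ : (p j).[V`_i] = 0) ?mulr0 //.
    by apply/eqP; rewrite -[i]/(val i') -p0 eq_sym.
  move/(max_poly_roots nz)/(_ uV); rewrite ltnNge => /negP; case.
  rewrite (leq_trans (size_polyD _ _)) // geq_max size_polyXn size_polyN ltnW //=.
  apply: (leq_trans (size_sum _ _ _)); apply/bigmax_leqP => j _.
  by rewrite (leq_trans (size_scale_leq _ _)) ?sp.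
(* In degree [N - 1] the term X^q contributes nothing since [q < N - 1], and each [p j] is monic of
   that degree. *)
have := congr1 (fun g : {poly k} => g`_N.-1) D0.
rewrite coefB coefXn coef_sum coef0 gtn_eqF ?sub0r; last first.
  by rewrite -ltnS prednK // (leq_trans _ lt).
move/eqP; rewrite oppr_eq0 => /eqP E; rewrite -[RHS]E.
apply: eq_bigr => j _; rewrite coefZ (_ : (p j)`_N.-1 = 1) ?mulr1 //.
have /monicP := monic_prod_XsubC (enum (predC1 j)) predT (fun i : 'I_N => V`_i).
by rewrite lead_coefE -/(p j) sp.
Qed.

(** Sum [f] over the grid against product weights. If the degree were too small, each monomial would
    have some exponent below |V_b| - 1 and its weighted sum would vanish; yet the total reduces to
    its nonzero term at [v0]. Recall that [msize] is the degree plus one. *)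
Lemma grid_degree n (V : 'I_n -> seq k) (v0 : 'I_n -> k) (f : {mpoly k[n]}) :
  (forall b, uniq (V b)) -> (forall b, v0 b \in V b) ->
  (forall y : 'I_n -> k, (forall b, y b \in V b) -> (exists b, y b != v0 b) ->
     f.@[y] = 0) ->
  f.@[v0] != 0 -> (\sum_b (size (V b)).-1 < msize f)%N.
Proof.
move=> uV v0V f0 nz; rewrite ltnNge; apply/negP => le.
(* A common bound on the sizes lets functions into one type ['I_M] index the grid; the weights are
   extended by 0 beyond [size (V b)]. *)
pose M := (\max_b size (V b))%N.
have NM b : (size (V b) <= M)%N by apply: leq_bigmax.
have /fin_all_exists[w hw] b : exists w : 'I_M -> k,
    (forall j : 'I_M, (w j != 0) = (j < size (V b))%N) /\
    forall q, (q.+1 < size (V b))%N -> \sum_(j < M) w j * (V b)`_j ^+ q = 0.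
  have [w [wn w0]] := exists_annihilating_weights (uV b).
  exists (fun j => if insub (val j) is Some i then w i else 0); split.
    by move=> j; case: insubP => [i ->|/negPf ->]; rewrite ?wn ?eqxx.
  move=> q lt; rewrite -[RHS](w0 q lt) (bigID (fun j : 'I_M => (j < size (V b))%N)) /=.
  rewrite [X in _ + X]big1 ?addr0 => [|j]; last first.
    by case: insubP => [i ->|]; rewrite ?mul0r.
  rewrite (big_ord_narrow (NM b)); apply: eq_bigr => j _ /=.
  by rewrite valK.
pose S := \sum_(t : {ffun 'I_n -> 'I_M}) f.@[fun b => (V b)`_(t b)] * \prod_b w b (t b).
have S0 : S = 0.
  rewrite /S; under eq_bigr do rewrite mevalE mulr_suml.
  rewrite exchange_big big_seq big1 // => m /msize_mdeg_lt ltm.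
  have [b hb] : exists b, (m b < (size (V b)).-1)%N.
    apply/existsP; apply: contraTT ltm; rewrite negb_exists -leqNgt => /forallP h.
    by rewrite (leq_trans le) // mdegE leq_sum // => b _; rewrite leqNgt.
  transitivity (f@_m * \prod_b \sum_(j < M) w b j * (V b)`_j ^+ m b).
    rewrite bigA_distr_bigA mulr_sumr; apply: eq_bigr => t _.
    by rewrite -mulrA -big_split; congr (_ * _); apply: eq_bigr => c _; rewrite mulrC.
  rewrite (bigD1 b) //= (hw b).2 ?mul0r ?mulr0 //.
  by case: (size (V b)) hb.
have idx b : (index (v0 b) (V b) < M)%N by rewrite (leq_trans _ (NM b)) // index_mem.
pose t0 := [ffun b => Ordinal (idx b)].
have Vt0 b : (V b)`_(t0 b) = v0 b by rewrite ffunE /= nth_index.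
suff /eqP : S = f.@[v0] * \prod_b w b (t0 b).
  rewrite S0 eq_sym mulf_eq0 (negPf nz) => /prodf_eq0[b _].
  by apply/negP; rewrite (hw b).1 ffunE /= index_mem.
rewrite /S (bigD1 t0) //= [X in _ + X]big1 ?addr0 => [|t ne].
  by congr (_ * _); apply: meval_eq => b; rewrite Vt0.
have [/forallP lt|] := boolP [forall b, t b < size (V b)]%N; last first.
  rewrite negb_forall => /existsP[b]; rewrite -(hw b).1 negbK => /eqP E.
  by rewrite (bigD1 b) //= E mul0r mulr0.
rewrite f0 ?mul0r // => [b|]; first exact: mem_nth.
have [b hb] : exists b, t b != t0 b.
  apply/existsP; apply: contraNT ne; rewrite negb_exists => /forallP h.
  by apply/eqP/ffunP => b; have /eqP := negPn (h b).
exists b; apply: contraNneq hb; rewrite -Vt0 => /(uniqP 0 (uV b)) E.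
apply/eqP/val_inj/E; rewrite inE ?lt //.
by rewrite ffunE /= index_mem.
Qed.

End Grid.

(** * Affine charts and degrees of determinants *)

Section LowerBound.

Variables (k : closedFieldType) (n : nat).

Definition transversal_form (u : 'I_n -> k) : {mpoly k[n.+1]} :=
  'X_ord0 + \sum_b u b *: 'X_(lift ord0 b).

Lemma transversal_form_homog u : transversal_form u \is 1.-homog.
Proof.
have hX j : ('X_j : {mpoly k[n.+1]}) \is 1.-homog by rewrite dhomogX; apply/eqP/mdeg1.
by apply: rpredD => //; apply: rpred_sum => b _; apply: rpredZ.
Qed.

Lemma meval_transversal_form u (x : 'I_n.+1 -> k) :
  (transversal_form u).@[x] = x ord0 + \sum_b u b * x (lift ord0 b).
Proof.
rewrite mevalD mevalXU raddf_sum; congr (_ + _); apply: eq_bigr => b _.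
by rewrite /= mevalZ mevalXU.
Qed.

(** With u_b = t^(b+1), the value at [P j] is a polynomial in t whose coefficients are the
    coordinates of [P j]; t is chosen off the roots of the product of these polynomials. *)
Lemma exists_transversal_form s (P : 'I_s -> 'rV[k]_n.+1) : (forall j, P j != 0) ->
  exists u, forall j, (transversal_form u).@[P j 0] != 0.
Proof.
move=> nzP; pose r j : {poly k} := \poly_(l < n.+1) P j 0 (inord l).
have nzr : \prod_j r j != 0.
  apply/prodf_neq0 => j _; have [l nz] := rV0Pn _ (nzP j).
  by apply: contraNneq nz => /polyP/(_ l); rewrite coef_poly ltn_ord coef0 inord_val => ->.
have [t] := poly_nonroot nzr; rewrite horner_prod => /prodf_neq0 nzt.
exists (fun b => t ^+ b.+1) => j; rewrite (_ : _.@[_] = (r j).[t]) ?nzt //.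
rewrite horner_poly meval_transversal_form big_ord_recl expr0 mulr1 inord_val.
congr (_ + _); apply: eq_bigr => b _; rewrite mulrC; congr (P j 0 _ * _).
by rewrite inord_val.
Qed.

(** The chart where [transversal_form u] equals 1: coordinate 0 is solved from the others. *)
Definition affine_chart (u : 'I_n -> k) : 'I_n.+1 -> {mpoly k[n]} := fun j =>
  if unlift ord0 j is Some b then 'X_b else 1 - \sum_b u b *: 'X_b.

Definition affine_point (u y : 'I_n -> k) : 'rV[k]_n.+1 :=
  \row_j (if unlift ord0 j is Some b then y b else 1 - \sum_b u b * y b).

Lemma meval_affine_chart u y f :
  (mmap (@mpolyC n k) (affine_chart u) f).@[y] = f.@[affine_point u y 0].
Proof.
elim/mpoly_ring_ind: f => [c|j|f g Ef Eg|f g Ef Eg].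
- by rewrite mmapC !mevalC.
- rewrite mmapX mmap1U mevalXU mxE /affine_chart; case: unliftP => [b _|_].
    by rewrite mevalXU.
  rewrite mevalB meval1; congr (_ - _); rewrite raddf_sum; apply: eq_bigr => b _.
  by rewrite /= mevalZ mevalXU.
- by rewrite mmapD !mevalD Ef Eg.
- by rewrite (rmorphM (mmap (@mpolyC n k) _)) /= !mevalM Ef Eg.
Qed.

Lemma msizeM_leq (f g : {mpoly k[n]}) a b :
  (msize f <= a.+1)%N -> (msize g <= b.+1)%N -> (msize (f * g) <= (a + b).+1)%N.
Proof.
have [->|nzf] := eqVneq f 0; first by rewrite mul0r msize0.
have [->|nzg] := eqVneq g 0; first by rewrite mulr0 msize0.
move=> lef leg; rewrite msizeM // -ltnS prednK; last first.
  by rewrite addn_gt0 lt0n msize_poly_eq0 nzf.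
by rewrite (leq_trans (leq_add lef leg)) // addnS addSn.
Qed.

Lemma msize_affine_chart u e f : f \is e.-homog ->
  (msize (mmap (@mpolyC n k) (affine_chart u) f) <= e.+1)%N.
Proof.
move=> /dhomogP hf; rewrite /mmap big_seq; apply: (leq_trans (msize_sum _ _ _)).
apply/bigmax_leqP_seq => m _ /hf <-.
rewrite mul_mpolyC; apply: (leq_trans (msizeZ_le _ _)).
rewrite -[Measure.sort _ _]/(mdeg m) mdegE /mmap1.
apply: (big_rec2 (fun (x : {mpoly k[n]}) y => (msize x <= y.+1)%N)) => [|j x y _ IH].
  by rewrite msize1.
apply: msizeM_leq => //.
have le2 : (msize (affine_chart u j) <= 2)%N.
  rewrite /affine_chart; case: unliftP => [b _|_]; first by rewrite msizeX mdeg1.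
  rewrite (leq_trans (msizeD_le _ _)) // geq_max msize1 msizeN /=.
  apply: (leq_trans (msize_sum _ _ _)); apply/bigmax_leqP_seq => b _ _.
  by apply: (leq_trans (msizeZ_le _ _)); rewrite msizeX mdeg1.
elim: (m j) => [|a IHa]; first by rewrite expr0 msize1.
by rewrite exprS; apply: (@msizeM_leq _ _ 1 a).
Qed.

(** A term of the determinant either has a zero entry or satisfies [d (t b) <= N b] for all [b]. In
    the second case the truncated subtractions are exact and add up to a degree independent of the
    permutation. *)
Lemma det_homog_sub (M : 'M[{mpoly k[n.+1]}]_n) (N d : 'I_n -> nat) :
  (forall b l, M b l \is (N b - d l)%N.-homog /\ ((N b < d l)%N -> M b l = 0)) ->
  \det M \is (\sum_b N b - \sum_l d l)%N.-homog /\
  (\det M != 0 -> (\sum_l d l <= \sum_b N b)%N).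
Proof.
move=> hM.
have dperm (t : 'S_n) : (\sum_b d (t b) = \sum_l d l)%N.
  by rewrite [RHS](reindex_inj (@perm_inj _ t)).
have term t : \prod_b M b (t b) = 0 \/ forall b, (d (t b) <= N b)%N.
  have [/forallP|] := boolP [forall b, d (t b) <= N b]%N; first by right.
  rewrite negb_forall => /existsP[b]; rewrite -ltnNge => lt; left.
  by rewrite (bigD1 b) //= (hM b (t b)).2 ?mul0r.
split.
  apply: rpred_sum => t _; rewrite rpredMsign.
  have [->|le] := term t; first exact: rpred0.
  rewrite -(dperm t) -sumnB => [|b _]; last exact: le.
  by apply: dhomog_prodE => b _; case: (hM b (t b)).
apply: contraNT => nle; apply/eqP/big1 => t _.
have [->|le] := term t; first by rewrite mulr0.
by case/negP: nle; rewrite -(dperm t) leq_sum.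
Qed.

End LowerBound.

(** * Lower bound for the degree of a reduced separator *)

Section NoLowSeparator.

Variables (k : closedFieldType) (n s : nat) (P : 'I_s -> 'rV[k]_n.+1).
Variables (G : 'I_n -> {mpoly k[n.+1]}) (d : 'I_n -> nat) (u : 'I_n -> k).
Hypothesis hP : distinct_points P.
Hypothesis hG : forall l, G l \is (d l).-homog.
Hypothesis hI : forall f, (forall i, point_ideal (P i) f) <->
  ideal_gen (fun g => exists l, g = G l) f.
Hypothesis hu : forall j, (transversal_form u).@[P j 0] = 1.

Let L := transversal_form u.
Let V b := undup [seq P j 0 (lift ord0 b) | j : 'I_s].

Lemma affine_pointE j : affine_point u (fun b => P j 0 (lift ord0 b)) = P j.
Proof.
apply/rowP => l; rewrite mxE; case: (unliftP ord0 l) => [b ->|->] //.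
by have := hu j; rewrite meval_transversal_form => <-; rewrite addrK.
Qed.

(** The product of the hyperplanes x_b = v, made homogeneous by [L], which is 1 on the chosen
    representatives of X. *)
Let grid_form b : {mpoly k[n.+1]} := \prod_(v <- V b) ('X_(lift ord0 b) - v *: L).

Let grid_form_homog b : grid_form b \is (size (V b)).-homog.
Proof.
rewrite -sum1_size; apply: dhomog_prodE => v _.
apply: rpredB; first by rewrite dhomogX; apply/eqP/mdeg1.
by apply: rpredZ; apply: transversal_form_homog.
Qed.

Let mem_V b j : P j 0 (lift ord0 b) \in V b.
Proof. by rewrite mem_undup; apply/map_f/mem_enum. Qed.

Let grid_form_point j b : point_ideal (P j) (grid_form b).
Proof.
apply/(point_ideal_homog _ (grid_form_homog b)); rewrite rmorph_prod.
rewrite (big_rem _ (mem_V b j)) /= mevalB mevalZ mevalXU hu mulr1 subrr.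
by rewrite mul0r.
Qed.

Lemma separator_degree_ge_normalized i e f : f \is e.-homog -> f.@[P i 0] != 0 ->
  (forall j, j != i -> f.@[P j 0] = 0) -> (\sum_l (d l).-1 <= e)%N.
Proof.
move=> hf fi fj.
have /fin_all_exists[T hT] b : exists T : 'I_n -> {mpoly k[n.+1]},
    (forall l, T l \is (size (V b) - d l)%N.-homog /\ ((size (V b) < d l)%N -> T l = 0)) /\
    grid_form b = \sum_l T l * G l.
  have /hI/ideal_gen_range[a Ea] : forall j, point_ideal (P j) (grid_form b).
    by move=> j; apply: grid_form_point.
  exact: homog_combination (grid_form_homog b) hG Ea.
pose M : 'M[{mpoly k[n.+1]}]_n := \matrix_(b, l) T b l.
pose ME (q : 'rV[k]_n.+1) : 'M[k]_n := \matrix_(b, l) (T b l).@[q 0].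
have detE (q : 'rV[k]_n.+1) : (\det M).@[q 0] = \det (ME q).
  by rewrite -det_map_mx; congr (\det _); apply/matrixP => l b; rewrite !mxE.
have [|hdet nzdet] := @det_homog_sub _ _ M (fun b => size (V b)) d.
  by move=> b l; rewrite mxE; apply: (hT b).1.
have deti : (\det M).@[P i 0] != 0.
  rewrite detE; apply/negP => /det0P[v nzv vM].
  have [b0 nz] := rV0Pn _ nzv.
  (* Since L(w) = 0, moving along [w] stays in the chart and changes only coordinate [b0]. At [P i]
     the grid form of [b0] is then the only one with a nonzero derivative, which contradicts the
     relation given by [v]. *)
  pose w : 'rV[k]_n.+1 :=
    \row_j (if unlift ord0 j is Some b then (b == b0)%:R else - u b0).
  have wL : L.@[w 0] = 0.
    rewrite meval_transversal_form mxE unlift_none (bigD1 b0) //= mxE liftK eqxx mulr1.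
    by rewrite big1 ?addr0 ?addNr // => b /negPf ne; rewrite mxE liftK ne mulr0.
  have dV b : exists2 c, c != 0 & dder (P i) w (grid_form b) = (b == b0)%:R * c.
    exists (\prod_(v <- rem (P i 0 (lift ord0 b)) (V b)) (P i 0 (lift ord0 b) - v)).
      rewrite prodf_seq_neq0; apply/allP => x /=.
      by rewrite mem_rem_uniq ?undup_uniq // inE subr_eq0 eq_sym => /andP[].
    rewrite /grid_form (big_rem _ (mem_V b i)) /= dderM.
    rewrite mevalB mevalZ mevalXU hu mulr1 subrr mul0r add0r.
    rewrite dder_linear_form; last first.
      apply: rpredB; first by rewrite dhomogX; apply/eqP/mdeg1.
      by apply: rpredZ; apply: transversal_form_homog.
    rewrite mevalB mevalZ wL mulr0 subr0 mevalXU mxE liftK; congr (_ * _).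
    rewrite rmorph_prod; apply: eq_bigr => c _.
    by rewrite /= mevalB mevalZ mevalXU hu mulr1.
  have : \sum_b v 0 b * dder (P i) w (grid_form b) = 0.
    transitivity (\sum_l (v *m ME (P i)) 0 l * dder (P i) w (G l)).
      under [RHS]eq_bigr do rewrite mxE mulr_suml.
      rewrite exchange_big; apply: eq_bigr => b _.
      rewrite (hT b).2 dder_sum mulr_sumr; apply: eq_bigr => l _.
      by rewrite dderM (generator_eval hI) mulr0 addr0 mxE mulrA.
    by rewrite vM big1 // => l _; rewrite mxE mul0r.
  rewrite (bigD1 b0) //= [X in _ + X]big1 ?addr0 => [/eqP|b /negPf ne].
    by have [c nzc ->] := dV b0; rewrite eqxx mul1r mulf_eq0 (negPf nz) (negPf nzc).
  by have [c _ ->] := dV b; rewrite ne mul0r mulr0.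
have dle : (\sum_l d l <= \sum_b size (V b))%N.
  by apply: nzdet; apply: contraNneq deti => ->; rewrite meval0.
(* In the chart, [f * \det M] vanishes on the grid except at [P i]: the factor [f] handles the other
   points of X, and [\det M] the points off X. *)
have := @grid_degree k n V (fun b => P i 0 (lift ord0 b))
  (mmap (@mpolyC n k) (affine_chart u) (f * \det M)).
rewrite meval_affine_chart affine_pointE mevalM mulf_neq0 // => grid.
have {grid} lt : (\sum_b (size (V b)).-1 <
    (e + (\sum_b size (V b) - \sum_l d l)).+1)%N.
  apply: leq_trans (msize_affine_chart u (dhomogM hf hdet)).
  apply: grid => // [b|y yV [b0 nb0]]; first exact: undup_uniq.
  set q := affine_point u y.
  have Lq : L.@[q 0] = 1.
    rewrite meval_transversal_form mxE unlift_none.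
    by under [X in _ + X]eq_bigr do rewrite mxE liftK; rewrite subrK.
  rewrite meval_affine_chart -/q mevalM.
  case: (classic (exists j, q = P j)) => [[j Ej]|nP].
    rewrite Ej fj ?mul0r //; apply: contraNneq nb0 => <-.
    by rewrite -Ej mxE liftK.
  (* A form of I_X that is nonzero at [q] shows that G(q) is nonzero; M(q) kills it because the grid
     forms vanish at [q]. *)
  have [|a [A [hA Aq AP]]] := @exists_avoiding_form _ _ _ P hP predT q.
    move=> j _ c Eq; case: nP; exists j; move: Lq.
    rewrite Eq eval_scale (meval_homog_scale _ _ (transversal_form_homog u)) hu.
    by rewrite mulr1 expr1 => ->; rewrite scale1r.
  have /hI/ideal_gen_range[c Ec] : forall j, point_ideal (P j) A.
    by move=> j; apply/(point_ideal_homog _ hA)/AP.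
  suff /eqP -> : (\det M).@[q 0] == 0 by rewrite mulr0.
  rewrite detE -det_tr; apply/det0P; exists (\row_l (G l).@[q 0]).
    apply: contraNneq Aq => /rowP G0; rewrite Ec raddf_sum big1 // => l _.
    by rewrite /= mevalM; have := G0 l; rewrite !mxE => ->; rewrite mulr0.
  apply/rowP => b; rewrite !mxE.
  transitivity (grid_form b).@[q 0].
    rewrite (hT b).2 raddf_sum; apply: eq_bigr => l _.
    by rewrite !mxE /= mevalM mulrC.
  rewrite rmorph_prod (big_rem _ (yV b)) /= mevalB mevalZ mevalXU Lq mulr1 mxE liftK.
  by rewrite subrr mul0r.
have Vgt0 b : (0 < size (V b))%N.
  by rewrite -has_predT; apply/hasP; exists (P i 0 (lift ord0 b)).
have dgt0 l : (0 < d l)%N := generator_degree_gt0 hP hG hI i l.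
have predE (c : 'I_n -> nat) : (forall b, 0 < c b)%N ->
    (\sum_b (c b).-1 = \sum_b c b - n)%N.
  move=> c0; under eq_bigr do rewrite -subn1.
  by rewrite sumnB // sum_nat_const card_ord muln1.
rewrite (predE d) // leq_subLR; move: lt; rewrite predE // ltnS leq_subLR.
by rewrite addnA addnC -leq_subLR subKn.
Qed.

End NoLowSeparator.

(** Dividing each row [P j] by its value under a transversal form reaches the normalized case; point
    ideals and vanishing of forms are unaffected. *)
Lemma separator_degree_ge (k : closedFieldType) (n s : nat) (P : 'I_s -> 'rV[k]_n.+1)
    (G : 'I_n -> {mpoly k[n.+1]}) (d : 'I_n -> nat) :
  distinct_points P -> (forall l, G l \is (d l).-homog) ->
  (forall f, (forall i, point_ideal (P i) f) <->
     ideal_gen (fun g => exists l, g = G l) f) ->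
  forall i e f, f \is e.-homog -> f.@[P i 0] != 0 ->
  (forall j, j != i -> f.@[P j 0] = 0) -> (\sum_l (d l).-1 <= e)%N.
Proof.
move=> hP hG hI i e f hf fi fj.
have [u hu] := exists_transversal_form hP.1.
pose c j := ((transversal_form u).@[P j 0])^-1.
have nzc j : c j != 0 by rewrite invr_eq0.
have fE j : f.@[(c j *: P j) 0] = c j ^+ e * f.@[P j 0].
  by rewrite eval_scale (meval_homog_scale _ _ hf).
apply: (@separator_degree_ge_normalized _ _ _ (fun j => c j *: P j) G d u _ _ _ _ i)
  hf _ _ => //.
- split=> [j|j l ne b]; first by rewrite scaler_eq0 negb_or nzc hP.1.
  move=> /(congr1 (fun v => (c l)^-1 *: v)); rewrite !scalerA mulVf // scale1r.
  exact: hP.2.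
- by move=> g; rewrite -hI; split=> h j; apply/(point_ideal_scale _ _ (nzc j)); apply: h.
- move=> j; rewrite eval_scale (meval_homog_scale _ _ (transversal_form_homog u)).
  by rewrite expr1 mulVf.
- by rewrite fE; apply: mulf_neq0 => //; apply: expf_neq0.
- by move=> j /fj fj0; rewrite fE fj0 mulr0.
Qed.

(** * Separators of fat points *)

(** The multiplicity of [t] is a difference of two such counts. This recovers degrees from Hilbert
    functions. *)
Lemma perm_eq_count_leq (s1 s2 : seq nat) :
  (forall t, count (fun e => e <= t)%N s1 = count (fun e => e <= t)%N s2) ->
  perm_eq s1 s2.
Proof.
move=> h.
have split (r : seq nat) t : count (fun e => e <= t)%N r =
    (count_mem t r + count (fun e => e < t)%N r)%N.
  rewrite -count_predUI [X in (_ + X)%N](_ : _ = 0%N) ?addn0.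
    by apply: eq_count => e; rewrite /= leq_eqVlt.
  rewrite -(count_pred0 r); apply: eq_count => e /=.
  by case: eqP => // ->; rewrite ltnn.
have lt t : count (fun e => e < t)%N s1 = count (fun e => e < t)%N s2.
  have lt0 r : count (fun e => e < 0)%N r = 0%N.
    by apply/eqP; rewrite -leqn0 leqNgt -has_count; apply/hasPn.
  by case: t => [|t]; [rewrite !lt0 | apply: h].
apply/allP => t _ /=; move: (h t); rewrite !split lt.
by move/addIn => ->.
Qed.

Section Monomials.

Variables (n m : nat).

Definition monomials : seq 'X_{1..n.+1} :=
  [seq s2m t | t : m.-tuple 'I_n.+1 <- enum (basis n.+1 m)].

Lemma mem_monomials a : (a \in monomials) = (mdeg a == m).
Proof. by rewrite -basis_cover. Qed.

Lemma size_monomials : size monomials = 'C(m + n, n).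
Proof. by rewrite mpoly.size_basis -[RHS]bin_sub ?leq_addl // addnK. Qed.

Lemma homog_monomials (R : comNzRingType) (A : {mpoly R[n.+1]}) : A \is m.-homog ->
  A = \sum_(a <- monomials) A@_a *: 'X_[a].
Proof.
move=> hA; apply/mpolyP => b; rewrite raddf_sum /=.
under eq_bigr do rewrite mcoeffZ mcoeffX.
have [bm|bm] := boolP (b \in monomials).
  rewrite (bigD1_seq b) ?uniq_basis //= eqxx mulr1 big1 ?addr0 // => a /negPf ->.
  by rewrite mulr0.
rewrite big1_seq => [|a /andP[_ am]].
  by apply: (dhomog_nemf_coeff hA); rewrite -mem_monomials.
by rewrite (_ : (a == b) = false) ?mulr0 //; apply: contraNF bm => /eqP <-.
Qed.

Lemma coef_sum_monomials (R : comNzRingType) (c : 'X_{1..n.+1} -> R) b :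
  (\sum_(a <- monomials) c a *: 'X_[a])@_b = if b \in monomials then c b else 0.
Proof.
rewrite raddf_sum /=; under eq_bigr do rewrite mcoeffZ mcoeffX.
case: ifPn => bm.
  rewrite (bigD1_seq b) ?uniq_basis //= eqxx mulr1 big1 ?addr0 // => a /negPf ->.
  by rewrite mulr0.
rewrite big1_seq // => a /andP[_ am].
by rewrite (_ : (a == b) = false) ?mulr0 //; apply: contraNF bm => /eqP <-.
Qed.

End Monomials.

Lemma dim_lker_surjective (k : fieldType) (V : vectType k) c (phi : 'Hom(V, 'rV[k]_c)) :
  (forall v, exists f, phi f = v) -> (\dim (lker phi) + c)%N = \dim {:V}.
Proof.
move=> sur; rewrite -(limg_ker_dim phi fullv) capfv; congr (_ + _)%N.
have -> : limg phi = fullv.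
  by apply/vspaceP => v; rewrite memvf; have [f <-] := sur v; rewrite memv_img ?memvf.
by rewrite dimvf dim_matrix; apply/esym/mul1n.
Qed.

Section FatPointsOnCI.

Variables (k : closedFieldType) (n s : nat) (P : 'I_s -> 'rV[k]_n.+2).
Variables (G : 'I_n.+1 -> {mpoly k[n.+2]}) (d : 'I_n.+1 -> nat) (m : nat).
Hypothesis hP : distinct_points P.
Hypothesis hG : forall l, G l \is (d l).-homog.
Hypothesis hI : forall f, (forall i, point_ideal (P i) f) <->
  ideal_gen (fun g => exists l, g = G l) f.
Implicit Types (f g h : {mpoly k[n.+2]}) (A : {mpoly {mpoly k[n.+2]}[n.+1]}).

Let Z := fun _ : 'I_s => m.+1.
Let IZ := fat_ideal P Z.
Let IZ' i := fat_ideal P (lower_mult Z i).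
Let mons := monomials n m.
Let sigma := (\sum_l (d l).-1)%N.

Lemma fat_idealD (mu : 'I_s -> nat) f g :
  fat_ideal P mu f -> fat_ideal P mu g -> fat_ideal P mu (f + g).
Proof. by move=> hf hg j; exact: ideal_genD (hf j) (hg j). Qed.

Lemma fat_idealM (mu : 'I_s -> nat) f g : fat_ideal P mu g -> fat_ideal P mu (f * g).
Proof. by move=> hg j; exact: ideal_genM (hg j). Qed.

Lemma fat_ideal_sum (mu : 'I_s -> nat) (I : Type) (r : seq I) (D : pred I)
    (F : I -> {mpoly k[n.+2]}) :
  (forall l, D l -> fat_ideal P mu (F l)) -> fat_ideal P mu (\sum_(l <- r | D l) F l).
Proof. by move=> hF j; apply: ideal_gen_sum => l Dl; apply: hF. Qed.

Lemma fat_ideal0 (mu : 'I_s -> nat) : fat_ideal P mu 0.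
Proof. by move=> j; apply: ideal_gen0. Qed.

Lemma fat_ideal_lowerP i f : IZ' i f <->
  ideal_pow (point_ideal (P i)) m f /\
  forall j, j != i -> ideal_pow (point_ideal (P j)) m.+1 f.
Proof.
split=> [h|[hi hj] j].
  split=> [|j /negPf ne]; first by have := h i; rewrite /lower_mult eqxx subn1.
  by have := h j; rewrite /lower_mult ne subn0.
rewrite /lower_mult; have [->|ne] := eqVneq j i; first by rewrite subn1.
by rewrite subn0; apply: hj.
Qed.

Lemma fat_ideal_lower_sub i f : IZ f -> IZ' i f.
Proof.
move=> h; apply/fat_ideal_lowerP; split=> [|j _]; last exact: h.
exact/ideal_pow_lower/h.
Qed.

Lemma point_ideal_mul_lower i f g : point_ideal (P i) f -> IZ' i g -> IZ (f * g).
Proof.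
move=> hf /fat_ideal_lowerP[gi gj] j; have [->|ne] := eqVneq j i.
  exact: ideal_powS.
by apply: ideal_genM; apply: gj.
Qed.

Lemma lower_form i f : IZ' i f -> exists2 A, A \is m.-homog & f = A.@[G].
Proof.
move=> /fat_ideal_lowerP[hi hj]; apply: (symbolic_power hP hI) => j.
by have [->|ne] := eqVneq j i => //; apply/ideal_pow_lower/hj.
Qed.

Lemma prod_generators_homog a :
  \prod_l G l ^+ a l \is (\sum_l d l * a l)%N.-homog.
Proof. by apply: dhomog_prodE => l _; apply: dhomogMn. Qed.

(** I_Z is I_X^(m+1), generated by products of the forms [G l]; the component is taken in each
    coefficient, shifted by the degree of its monomial in [G]. *)
Lemma fat_ideal_pihomog t f : IZ f -> IZ (pihomog mdeg t f).
Proof.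
move=> /(symbolic_power hP hI)[A /dhomogP hA ->] j.
pose B := \sum_(a <- msupp A) (if (\sum_l d l * a l <= t)%N then
  pihomog mdeg (t - \sum_l d l * a l) A@_a else 0) *: 'X_[a].
rewrite (_ : pihomog _ _ _ = B.@[G]).
  apply: (meval_point_ideal_pow hI); rewrite /B big_seq; apply: rpred_sum => a /hA ha.
  by apply: rpredZ; rewrite dhomogX; apply/eqP.
rewrite mevalE raddf_sum [in RHS]raddf_sum; apply: eq_bigr => a _.
rewrite /= mevalZ mevalX (pihomogM _ _ (prod_generators_homog a)).
by case: ifP => _ //; rewrite mul0r.
Qed.

(** The leading term of [f] at [P i] in the local coordinates [G l]. It is a relation because [A] is
    not unique; [leading_uniq] shows that the vector is. *)
Definition leading i f (v : 'rV[k]_(size mons)) : Prop :=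
  exists A, [/\ A \is m.-homog, f = A.@[G] & v = \row_l (A@_(nth 0%MM mons l)).@[P i 0]].

Lemma leading_exists i f : IZ' i f -> exists v, leading i f v.
Proof. by move=> /lower_form[A hA E]; eexists; exists A. Qed.

Lemma leadingD i f g v w : leading i f v -> leading i g w -> leading i (f + g) (v + w).
Proof.
move=> [A [hA -> ->]] [B [hB -> ->]]; exists (A + B); split.
- exact: rpredD.
- by rewrite mevalD.
- by apply/rowP => l; rewrite !mxE mcoeffD mevalD.
Qed.

Lemma leadingM i a f v : leading i f v -> leading i (a * f) (a.@[P i 0] *: v).
Proof.
move=> [A [hA -> ->]]; exists (a *: A); split.
- exact: rpredZ.
- by rewrite mevalZ.
- by apply/rowP => l; rewrite !mxE mcoeffZ mevalM.
Qed.

Lemma leading_sum i (I : Type) (r : seq I) (F : I -> {mpoly k[n.+2]}) v :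
  (forall x, leading i (F x) (v x)) ->
  leading i (\sum_(x <- r) F x) (\sum_(x <- r) v x).
Proof.
move=> h; elim/big_ind2: _ => //; last by move=> *; apply: leadingD.
exists 0; split; [exact: rpred0 | by rewrite meval0 |].
by apply/rowP => l; rewrite !mxE mcoeff0 meval0.
Qed.

(** By [coef_point_ideal] the coefficients lie in the ideal of [P i]. Leading vectors thus depend
    only on classes modulo I_Z. *)
Lemma leading_fat_ideal i f v : IZ f -> leading i f v -> v = 0.
Proof.
move=> hf [A [hA E ->]]; apply/rowP => l; rewrite !mxE.
apply/point_ideal_eval/(coef_point_ideal hP hI hA); rewrite -E; exact: hf.
Qed.

Lemma leading_uniq i f g v w :
  leading i f v -> leading i g w -> IZ (f - g) -> v = w.
Proof.
move=> hf hg hfg; apply/eqP; rewrite -subr_eq0; apply/eqP.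
apply: (leading_fat_ideal (i := i) hfg).
rewrite -[- g]mulN1r -[- w]scaleN1r; apply: leadingD => //.
by have := leadingM (-1) hg; rewrite mevalN meval1.
Qed.

Lemma leading_span i (F : seq {mpoly k[n.+2]}) (v : 'I_(size F) -> 'rV[k]_(size mons))
    f w (a : 'I_(size F) -> {mpoly k[n.+2]}) :
  (forall l : 'I_(size F), leading i F`_l (v l)) -> leading i f w ->
  IZ (f - \sum_l a l * F`_l) -> w = \sum_l (a l).@[P i 0] *: v l.
Proof.
move=> hv hw; apply: (leading_uniq hw).
by apply: leading_sum => l; apply: leadingM.
Qed.

Section Separators.

Variables (i : 'I_s) (F : {mpoly k[n.+2]}).
Hypothesis hF : F \is sigma.-homog.
Hypothesis Fi : F.@[P i 0] != 0.
Hypothesis Fj : forall j, j != i -> F.@[P j 0] = 0.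

(** A homogeneous component of [h] that is nonzero at [P i] is a reduced separator, so its degree is
    at least [sigma], and [F] times a scaled power of a variable cancels its value at [P i]. *)
Lemma residual_ideal h : (forall j, j != i -> point_ideal (P j) h) ->
  exists c, forall j, point_ideal (P j) (h - c * F).
Proof.
move=> hj; rewrite (pihomog_partitionE (leqnn (msize h))).
apply: (big_ind (fun g => exists c, forall j, point_ideal (P j) (g - c * F))).
- by exists 0 => j; rewrite mul0r subrr; apply: ideal_gen0.
- move=> x y [c hc] [b hb]; exists (c + b) => j.
  by rewrite mulrDl opprD addrACA; apply: point_idealD.
move=> e _; have he := pihomogP mdeg e h; set g := pihomog mdeg e h in he *.
have gj j : j != i -> g.@[P j 0] = 0 by move=> /hj/point_idealP h0; apply: h0.
have [g0|nz] := eqVneq g.@[P i 0] 0.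
  exists 0 => j; rewrite mul0r subr0; apply/(point_ideal_homog _ he).
  by have [->|/gj] := eqVneq j i.
have le := separator_degree_ge hP hG hI he nz gj.
have [a nza] := rV0Pn _ (hP.1 i).
pose c : {mpoly k[n.+2]} :=
  (g.@[P i 0] / (F.@[P i 0] * P i 0 a ^+ (e - sigma))) *: 'X_a ^+ (e - sigma).
have hX : ('X_a : {mpoly k[n.+2]}) \is 1.-homog by rewrite dhomogX; apply/eqP/mdeg1.
have hc : c * F \is e.-homog.
  rewrite -(subnK le); apply: dhomogM => //; apply: rpredZ.
  by have := dhomogMn (e - sigma) hX; rewrite mul1n.
exists c => j; apply/(point_ideal_homog _ (rpredB he hc)); rewrite mevalB mevalM.
have [->|ne] := eqVneq j i; last by rewrite gj // Fj // mulr0 subrr.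
rewrite mevalZ rmorphXn /= mevalXU -!mulrA [_ * F.@[_]]mulrC mulVf ?mulr1 ?subrr //.
by apply: mulf_neq0 => //; apply: expf_neq0.
Qed.

Definition explicit_separators : seq {mpoly k[n.+2]} :=
  [seq F * \prod_l G l ^+ a l | a : 'X_{1..n.+1} <- mons].

Lemma size_explicit_separators : size explicit_separators = size mons.
Proof. exact: size_map. Qed.

Lemma explicit_formE (a : 'X_{1..n.+1}) (c : {mpoly k[n.+2]}) :
  c * \prod_l G l ^+ a l = (c *: 'X_[a] : {mpoly {mpoly k[n.+2]}[n.+1]}).@[G].
Proof. by rewrite mevalZ mevalX. Qed.

Lemma monomial_homog (a : 'X_{1..n.+1}) (c : {mpoly k[n.+2]}) : a \in mons ->
  (c *: 'X_[a] : {mpoly {mpoly k[n.+2]}[n.+1]}) \is m.-homog.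
Proof. by rewrite mem_monomials => ha; apply: rpredZ; rewrite dhomogX. Qed.

Lemma explicit_separator_point a j : a \in mons -> j != i ->
  ideal_pow (point_ideal (P j)) m.+1 (F * \prod_l G l ^+ a l).
Proof.
move=> ha ne; rewrite explicit_formE.
apply: (meval_point_ideal_powS hI (monomial_homog _ ha)) => b.
rewrite mcoeffZ mulrC; apply: point_idealM.
by apply/(point_ideal_homog _ hF)/Fj.
Qed.

Lemma explicit_separator_lower a : a \in mons -> IZ' i (F * \prod_l G l ^+ a l).
Proof.
move=> ha; apply/fat_ideal_lowerP; split=> [|j ne].
  by rewrite explicit_formE; apply/(meval_point_ideal_pow hI)/monomial_homog.
exact: explicit_separator_point.
Qed.

Lemma explicit_separator_leading a : a \in mons ->
  leading i (F * \prod_l G l ^+ a l)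
    (\row_l (F.@[P i 0] * (a == nth 0%MM mons l)%:R)).
Proof.
move=> ha; exists (F *: 'X_[a]); split; first exact: monomial_homog.
  exact: explicit_formE.
by apply/rowP => l; rewrite !mxE mcoeffZ mcoeffX mevalM rmorph_nat.
Qed.

Lemma explicit_separator_nonzero a : a \in mons ->
  ~ ideal_pow (point_ideal (P i)) m.+1 (F * \prod_l G l ^+ a l).
Proof.
move=> ha; rewrite explicit_formE.
move=> /(coef_point_ideal hP hI (monomial_homog _ ha))/(_ a)/point_ideal_eval/eqP.
by rewrite mcoeffZ mcoeffX eqxx mulr1 (negPf Fi).
Qed.

(** Write f = A(G). Order m + 1 at the other points puts the coefficients of [A] in their ideals, so
    each is a multiple of [F] modulo I_X; the error is a form of degree m in [G] with coefficients
    in I_X, hence lies in I_Z. *)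
Lemma explicit_generate f : IZ' i f -> exists c : 'X_{1..n.+1} -> {mpoly k[n.+2]},
  IZ (f - \sum_(a <- mons) c a * (F * \prod_l G l ^+ a l)).
Proof.
move=> hf; have [A hA E] := lower_form hf.
have /fat_ideal_lowerP[_ fj] := hf.
have res a : exists c, forall j, point_ideal (P j) (A@_a - c * F).
  apply: residual_ideal => j /fj; rewrite E => hp.
  exact: (coef_point_ideal hP hI hA hp).
pose c a := epsilon (inhabits 0) (fun c => forall j, point_ideal (P j) (A@_a - c * F)).
have hc a : forall j, point_ideal (P j) (A@_a - c a * F).
  exact: epsilon_spec (inhabits 0) _ (res a).
exists c; rewrite E (homog_monomials hA) raddf_sum -sumrB /=.
rewrite (_ : \sum_(a <- _) _ = (\sum_(a <- mons) (A@_a - c a * F) *: 'X_[a]).@[G]).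
  move=> j; apply: (meval_point_ideal_powS hI) => [|b].
    by rewrite big_seq; apply: rpred_sum => a; apply: monomial_homog.
  by rewrite coef_sum_monomials; case: ifP => _ //; apply: ideal_gen0.
rewrite raddf_sum; apply: eq_bigr => a _.
by rewrite /= !mevalZ mevalX mulrBl mulrA.
Qed.

Lemma generates_mod_mem (F' : seq {mpoly k[n.+2]}) :
  generates_mod IZ (IZ' i) F' -> forall l : 'I_(size F'), IZ' i F'`_l.
Proof.
move=> hgen l; apply/hgen; exists (fun j => (j == l)%:R).
rewrite (bigD1 l) //= eqxx mul1r big1 => [|j /negPf ->]; last by rewrite mul0r.
by rewrite addr0 subrr; apply: fat_ideal0.
Qed.

Lemma explicit_generates : generates_mod IZ (IZ' i) explicit_separators.
Proof.
have mem l : (l < size explicit_separators)%N -> nth 0%MM mons l \in mons.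
  by rewrite size_explicit_separators => /(mem_nth 0%MM).
move=> f; split=> [/explicit_generate[c hc]|[a ha]].
  exists (fun l => c (nth 0%MM mons l)); move: hc.
  rewrite (big_nth 0%MM) big_mkord -size_explicit_separators.
  congr (IZ (_ - _)); apply: eq_bigr => l _.
  by rewrite (nth_map 0%MM) // -size_explicit_separators.
rewrite -[f](subrK (\sum_(l < size explicit_separators) a l * explicit_separators`_l)).
apply: fat_idealD; first exact: fat_ideal_lower_sub.
apply: fat_ideal_sum => l _; apply: fat_idealM.
rewrite (nth_map 0%MM) -?size_explicit_separators //.
by apply/explicit_separator_lower/mem.
Qed.

(** The leading vectors of the explicit separators are F(P_i) times the standard basis, and they are
    combinations of those of [F']. This bounds the number of generators from below. *)
Lemma generates_mod_row_full (F' : seq {mpoly k[n.+2]}) :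
  generates_mod IZ (IZ' i) F' ->
  exists v : 'I_(size F') -> 'rV[k]_(size mons),
    (forall l : 'I_(size F'), leading i F'`_l (v l)) /\ row_full (\matrix_l v l).
Proof.
move=> hgen.
have /fin_all_exists[v hv] : forall l : 'I_(size F'), exists v, leading i F'`_l v.
  by move=> l; apply/leading_exists/generates_mod_mem.
exists v; split=> //; rewrite -sub1mx; apply/row_subP => l0.
pose a0 := nth 0%MM mons l0.
have ha0 : a0 \in mons by apply: mem_nth.
have [a ha] := (hgen _).1 (explicit_separator_lower ha0).
have E := leading_span hv (explicit_separator_leading ha0) ha.
suff -> : row l0 1%:M = (F.@[P i 0])^-1 *: \sum_l (a l).@[P i 0] *: v l.
  apply/scalemx_sub/summx_sub => l _; apply: scalemx_sub.
  by rewrite -[v l](rowK v); apply: row_sub.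
rewrite -E; apply/rowP => l; rewrite !mxE mulrA mulVf // mul1r.
by rewrite nth_uniq ?mpoly.uniq_basis.
Qed.

(** The two degrees differ only in the term of [P i]; Pascal's rule gives the difference. *)
Lemma fat_degree_lower :
  (fat_degree n.+1 Z - fat_degree n.+1 (lower_mult Z i))%N = size mons.
Proof.
rewrite /fat_degree (bigD1 i) //= [X in (_ - X)%N](bigD1 i) //=.
rewrite (eq_bigr (fun _ => 'C(m.+1 + n.+1 - 1, n.+1))) // subnDA.
rewrite [X in (_ - _ - X)%N](eq_bigr (fun _ => 'C(m.+1 + n.+1 - 1, n.+1))); last first.
  by move=> j /negPf ne; rewrite /lower_mult ne subn0.
rewrite subnAC addnK /lower_mult eqxx subn1 /= !addnS !subn1 /=.
by rewrite binS addKn size_monomials.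
Qed.

Lemma explicit_uniq : uniq explicit_separators.
Proof.
rewrite map_inj_in_uniq ?mpoly.uniq_basis // => a b ha hb E.
have l0 : (index a mons < size mons)%N by rewrite index_mem.
have := leading_uniq (explicit_separator_leading ha) (explicit_separator_leading hb).
rewrite E subrr => /(_ (@fat_ideal0 Z))/rowP/(_ (Ordinal l0)); rewrite !mxE nth_index //.
rewrite eqxx; case: eqP => // _ /eqP; rewrite mulr0 mulr1.
by rewrite (negPf Fi).
Qed.

Lemma explicit_minimal : minimal_separators P Z i explicit_separators.
Proof.
split.
- by rewrite explicit_uniq size_explicit_separators fat_degree_lower.
- move=> _ /mapP[a ha ->]; split.
  + by eexists; apply: (dhomogM hF (prod_generators_homog _)).
  + have /fat_ideal_lowerP[+ _] := explicit_separator_lower ha.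
    by rewrite /Z subn1.
  + exact: explicit_separator_nonzero.
  + by move=> j; apply: explicit_separator_point.
- exact: explicit_generates.
- move=> F' lt /generates_mod_row_full[v [_ /eqP full]].
  by move: lt; rewrite fat_degree_lower ltnNge -{1}full rank_leq_row.
Qed.

Lemma explicit_degrees :
  [seq (msize f).-1 | f <- explicit_separators] =
  [seq (sigma + \sum_l d l * a l)%N | a : 'X_{1..n.+1} <- mons].
Proof.
rewrite -map_comp; apply/eq_in_map => a ha /=.
have nz : F * \prod_l G l ^+ a l != 0.
  apply/eqP => E; apply: (explicit_separator_nonzero ha); rewrite E.
  exact: ideal_gen0.
have hom := dhomogM hF (prod_generators_homog a).
exact: dhomog_uniq nz (dhomog_msize hom) hom.
Qed.

Lemma exists_unit_form : exists L : {mpoly k[n.+2]}, L \is 1.-homog /\ L.@[P i 0] = 1.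
Proof.
have [a nza] := rV0Pn _ (hP.1 i); exists ((P i 0 a)^-1 *: 'X_a); split.
  by apply: rpredZ; rewrite dhomogX; apply/eqP/mdeg1.
by rewrite mevalZ mevalXU mulVf.
Qed.

(* M = I_Z' / I_Z is a free module over R / I_P = k[L] on any minimal set of
   separators, so dim M_t counts the separators of degree at most t. *)
Lemma hilbert_separators t (F' : seq {mpoly k[n.+2]}) : minimal_separators P Z i F' ->
  hilbert IZ t = (hilbert (IZ' i) t + count (fun f => (msize f).-1 <= t)%N F')%N.
Proof.
move=> [[_ sz] sepF hgen _]; rewrite fat_degree_lower in sz.
have [phi [sphi kphi]] := (hilbertP P Z t _).2 erefl.
have [psi [spsi kpsi]] := (hilbertP P (lower_mult Z i) t _).2 erefl.
suff dimE : (\dim (lker psi) = \dim (lker phi) + count (fun f => (msize f).-1 <= t) F')%N.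
  apply/(@addnI (\dim (lker phi))).
  rewrite (dim_lker_surjective sphi) -(dim_lker_surjective spsi) dimE -addnA.
  by rewrite (addnC (count _ _)).
have [v [hv full]] := generates_mod_row_full hgen.
(* [F'] has exactly [size mons] elements, so the matrix of leading vectors is square and
   invertible. *)
have /row_freeP[B WB] : row_free (\matrix_l v l) by rewrite /row_free (eqP full) sz.
have [L [hL Li]] := exists_unit_form.
pose e (l : 'I_(size F')) := (msize F'`_l).-1.
have hom (l : 'I_(size F')) : F'`_l \is (e l).-homog.
  have [[c hc] _ _ _] := sepF _ (mem_nth 0 (ltn_ord l)).
  exact: dhomog_msize hc.
pose K := [pred l | e l <= t]%N.
have cK : count (fun f => (msize f).-1 <= t)%N F' = #|K|.
  by rewrite -sum1_count (big_nth 0) big_mkord sum1_card.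
(* A power of [L] brings a separator to degree [t]; this makes sense for [e l <= t], that is for [l]
   in [K]. *)
pose x (l : 'I_(size F')) : dhomog n.+2 k t := indhomog t (L ^+ (t - e l) * F'`_l).
have xE l : (e l <= t)%N -> val (x l) = L ^+ (t - e l) * F'`_l.
  move=> le; rewrite /x /indhomog insubdK // -[X in X.-homog](subnK le).
  by apply: dhomogM => //; have := dhomogMn (t - e l) hL; rewrite mul1n.
have FIZ' := generates_mod_mem hgen.
pose E := [tuple phi (x (enum_val r)) | r < #|K|].
(* A relation puts a combination of the [x l] in I_Z. As [L] is 1 at [P i], the same coefficients
   give a relation between leading vectors, and [B] shows that they vanish. *)
have freeE : free E.
  apply/freeP => c Ec r0.
  have {Ec} : phi (\sum_r c r *: x (enum_val r)) = 0.
    rewrite -[RHS]Ec linear_sum; apply: eq_bigr => r _.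
    by rewrite linearZ; congr (_ *: _); rewrite -(tnth_nth 0 E) tnth_mktuple.
  move/kphi; rewrite (raddf_sum (@mpoly_of_dhomog n.+2 k t)) /= => Iz.
  have v0 : \sum_r c r *: v (enum_val r) = 0.
    apply: (leading_fat_ideal (i := i) Iz); apply: leading_sum => r.
    rewrite -[mpoly_of_dhomog _]/(val (x (enum_val r))) xE; last exact: (enum_valP r).
    rewrite -mul_mpolyC mulrA.
    have := leadingM ((c r)%:MP * L ^+ (t - e (enum_val r))) (hv (enum_val r)).
    by rewrite mevalM mevalC rmorphXn /= Li expr1n mulr1.
  have := congr1 (fun w => (w *m B) 0 (enum_val r0)) v0.
  rewrite mul0mx mulmx_suml summxE mxE.
  have coord r : (c r *: v (enum_val r) *m B) 0 (enum_val r0) = c r * (r == r0)%:R.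
    rewrite -scalemxAl mxE; congr (_ * _); rewrite -[v _](rowK v) -row_mul WB !mxE.
    by rewrite (inj_eq enum_val_inj).
  under eq_bigr do rewrite coord.
  by rewrite (bigD1 r0) //= eqxx mulr1 big1 ?addr0 // => r /negPf ->; rewrite mulr0.
have sub : (lker phi <= lker psi)%VS.
  apply/subvP => f; rewrite !memv_ker => /eqP/kphi If.
  by apply/eqP/kpsi; apply: fat_ideal_lower_sub.
(* The difference of dimensions is that of the image under [phi] of the degree [t] part of I_Z',
   which the images of the [x l] span. *)
rewrite -(limg_ker_dim phi (lker psi)) (capv_idPr sub); congr (_ + _)%N.
suff -> : (phi @: lker psi = <<E>>)%VS.
  by move: freeE; rewrite /free => /eqP ->; rewrite size_tuple cK.
apply/eqP; rewrite eqEsubv; apply/andP; split; last first.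
  apply/span_subvP => _ /mapP[r _ ->]; apply: memv_img; rewrite memv_ker.
  apply/eqP/kpsi; rewrite -[mpoly_of_dhomog _]/(val (x (enum_val r))) xE.
    by apply: fat_idealM; apply: FIZ'.
  exact: (enum_valP r).
apply/subvP => _ /memv_imgP[f + ->]; rewrite memv_ker => /eqP/kpsi/hgen[a].
have piE : pihomog mdeg t (\sum_l a l * F'`_l) = \sum_l pihomog mdeg t (a l * F'`_l).
  by rewrite raddf_sum.
move=> /(fat_ideal_pihomog t); rewrite pihomogB piE (pihomog_dE (dhomog_is_dhomog f)) => Ia.
(* In degree [t], [f] is the sum of the b_l F'_l modulo I_Z. Replacing [b l] by its value at [P i]
   times a power of [L] changes it by an element of the ideal of [P i], which carries I_Z' into
   I_Z. *)
pose b l := pihomog mdeg (t - e l) (a l).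
have Ib : IZ (val (f - \sum_(l in K) (b l).@[P i 0] *: x l)).
  rewrite raddfB raddf_sum /=.
  rewrite (_ : _ - _ = (val f - \sum_l pihomog mdeg t (a l * F'`_l)) +
    \sum_(l in K) (b l - (b l).@[P i 0] *: L ^+ (t - e l)) * F'`_l).
    apply: fat_idealD; [exact: Ia | apply: fat_ideal_sum => l le].
    apply: point_ideal_mul_lower (FIZ' l).
    apply/(@point_ideal_homog _ _ (P i) (t - e l)).
      apply: rpredB; first exact: pihomogP.
      by apply: rpredZ; have := dhomogMn (t - e l) hL; rewrite mul1n.
    by rewrite mevalB mevalZ rmorphXn /= Li expr1n mulr1 subrr.
  rewrite -addrA; congr (_ + _); rewrite [X in - X + _](bigID (mem K)) /=.
  rewrite [X in - (_ + X)]big1 ?addr0 => [|l]; last first.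
    by move=> nle; rewrite (pihomogM _ _ (hom l)); case: ifP => // le; case/negP: nle.
  rewrite -!sumrN -big_split; apply: eq_bigr => l le.
  rewrite /= (pihomogM _ _ (hom l)) (_ : (e l <= t)%N) // mulrBl addKr.
  by rewrite -[mpoly_of_dhomog _]/(val (x l)) xE // scalerAl.
have /kphi/eqP := Ib; rewrite linearB subr_eq0 => /eqP ->.
rewrite linear_sum; apply: memv_suml => l le; rewrite linearZ; apply: memvZ.
apply: memv_span; apply/mapP; exists (enum_rank_in le l); rewrite ?mem_enum //.
by rewrite enum_rankK_in.
Qed.

End Separators.

End FatPointsOnCI.

(** * Independence of the point of the support *)

Unset Implicit Arguments.

Theorem theorem6p4 (k : closedFieldType) (hchar : [pchar k] =i pred0)
  (n : nat) (hn : (0 < n)%N) (s : nat) (hs : (0 < s)%N)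
  (P : 'I_s -> 'rV[k]_n.+1) (hP : distinct_points P)
  (m : nat) (hm : (0 < m)%N) (hCI : complete_intersection P) :
  let Z := fun _ : 'I_s => m in
  (exists d : seq nat, forall i : 'I_s,
     separator_degrees P Z i d /\
     forall d' : seq nat, separator_degrees P Z i d' -> d' = d) /\
  (forall (i j : 'I_s) (t : nat),
     hilbert (fat_ideal P (lower_mult Z i)) t =
     hilbert (fat_ideal P (lower_mult Z j)) t).
Proof.
case: n hn P hP hCI => // n _ P hP [G [/fin_all_exists[d hG] hX]].
case: m hm => // m _ Z.
have hI f : (forall i, point_ideal (P i) f) <-> ideal_gen (fun g => exists l, g = G l) f.
  rewrite -hX vanishing_ideal_point; split=> [h _ [i ->] //|h i].
  by apply: h; exists i.
have /fin_all_exists[F hF] := exists_separator_sigma hP hG hI.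
pose ES i := explicit_separators G m (F i).
(* These degrees involve only [m] and the degrees of the generators, not the point. *)
pose degs := [seq (\sum_l (d l).-1 + \sum_l d l * a l)%N
  | a : 'X_{1..n.+1} <- monomials n m].
have minES i : minimal_separators P Z i (ES i).
  by have [h1 h2 h3] := hF i; apply: explicit_minimal hP hG hI _ _ h1 h2 h3.
have degES i : [seq (msize f).-1 | f <- ES i] = degs.
  by have [h1 h2 _] := hF i; apply: explicit_degrees hP hG hI _ _ h1 h2.
have hilb i t F' : minimal_separators P Z i F' ->
    hilbert (fat_ideal P Z) t = (hilbert (fat_ideal P (lower_mult Z i)) t +
      count (fun e => e <= t) [seq (msize f).-1 | f <- F'])%N.
  have [h1 h2 h3] := hF i; rewrite count_map.
  exact: hilbert_separators hP hG hI _ _ h1 h2 h3 t F'.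
split=> [|i j t]; last first.
  (* Adding the same count to either side gives the Hilbert function of Z. *)
  apply/eqP; rewrite -(eqn_add2r (count (fun e => e <= t)%N degs)).
  by rewrite -{1}(degES i) -(degES j) -!hilb.
exists (sort leq degs) => i; split; first by exists (ES i); rewrite degES.
(* For each [t], [F'] and the explicit set have equally many members of degree at most [t], both
   counts being H_Z(t) - H_Z'(t). *)
move=> _ [F' [minF' ->]]; apply/(perm_sortP leq_total leq_trans anti_leq).
apply: perm_eq_count_leq => t; have := hilb i t _ (minES i).
by rewrite (hilb i t _ minF') degES => /addnI.
Qed.
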